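(* Let $\mathfrak{h}_3\oplus\mathfrak{h}_3\oplus\mathbb{R}=(0,0,0,0,f^{12},f^{34},0)$ be endowed with the metric $$g=\sum_{i=1}^4f^i\odot f^i+2a\,f^1\odot f^3+2b\,f^2\odot f^4+E\,f^5\odot f^5+2F\,f^5\odot f^6+G\,f^6\odot f^6+f^7\odot f^7,$$ where $0\le a\le b<1$, $E,F,G\ge0$ and $EG-F^2>0$. Then there exists a purely coclosed $\mathrm{G}_2$-structure $\varphi$ on $\mathfrak{h}_3\oplus\mathfrak{h}_3\oplus\mathbb{R}$ with $g_\varphi=g$ if and only if, for some choice of sign $\varepsilon\in\{1,-1\}$, $$\left(ab+\varepsilon\sqrt{(1-a^2)(1-b^2)}\right)^2<1,\quad G=E,\quad F=-E\left(ab+\varepsilon\sqrt{(1-a^2)(1-b^2)}\right).$$ In particular, there are no purely coclosed $\mathrm{G}_2$-structures inducing a metric $g$ for which the decomposition $\mathfrak{h}_3\oplus\mathfrak{h}_3\oplus\mathbb{R}$ is orthogonal.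
   Context: Lie algebras are real and described by the tuple $(\mathrm{d}f^1,\dots,\mathrm{d}f^7)$ for a basis $\{f^1,\dots,f^7\}$ of $\mathfrak{n}^*$, with $f^{ij}=f^i\wedge f^j$; $\mathrm{d}$ is the Chevalley-Eilenberg differential ($\mathrm{d}\alpha(x,y)=-\alpha([x,y])$ for $\alpha\in\mathfrak{n}^*$, extended as a graded derivation of $\Lambda^\bullet\mathfrak{n}^*$). With $\{f_i\}$ the dual basis, the summands of $\mathfrak{h}_3\oplus\mathfrak{h}_3\oplus\mathbb{R}$ are the ideals $\langle f_1,f_2,f_5\rangle$, $\langle f_3,f_4,f_6\rangle$, $\langle f_7\rangle$. $\mathfrak{h}_3$ is the $3$-dimensional Heisenberg Lie algebra. The symmetric product is $f^i\odot f^j=\frac12(f^i\otimes f^j+f^j\otimes f^i)$. A $\mathrm{G}_2$-structure on a $7$-dimensional real vector space $V$ is a $3$-form $\varphi\in\Lambda^3V^*$ such that $(v\lrcorner\varphi)\wedge(v\lrcorner\varphi)\wedge\varphi\neq0$ for all $v\in V\smallsetminus\{0\}$. It determines a unique inner product $g_\varphi$ and orientation, with volume form $\mathrm{vol}_\varphi$, such that $g_\varphi(v,w)\mathrm{vol}_\varphi=\frac16\,(v\lrcorner\varphi)\wedge(w\lrcorner\varphi)\wedge\varphi$; $*_\varphi$ is the corresponding Hodge operator. $\varphi$ induces $g$ if $g_\varphi=g$. A $\mathrm{G}_2$-structure $\varphi$ on $\mathfrak{n}$ is purely coclosed if $\mathrm{d}*_\varphi\varphi=0$ and $\mathrm{d}\varphi\wedge\varphi=0$.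 *)

(* Defs.v *)
From HB Require Import structures.
From mathcomp Require Import all_boot all_order all_algebra.
From mathcomp Require Import reals.
Set Implicit Arguments.
Unset Strict Implicit.
Unset Printing Implicit Defensive.
Import Order.TTheory GRing.Theory Num.Theory.
Local Open Scope ring_scope.

(* V = R^n is 'rV[R]_n with basis f_i = delta_mx 0 i; the exterior algebra of
   V^* is given by coefficients: al S is the coefficient of
   f^S = f^{s_1} /\ ... /\ f^{s_k} for S = {s_1 < ... < s_k}. The codomain is
   R^o, not R, so that the library's pointwise scaling *: is available. *)
Notation exterior R n := {ffun {set 'I_n} -> R^o}.

Section Exterior.
Variables (R : realType) (n : nat).
Implicit Types (al be om : exterior R n) (S T : {set 'I_n}) (v w : 'rV[R]_n).

Definition ebasis S : exterior R n := [ffun T : {set 'I_n} => (T == S)%:R].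

Definition covec (i : 'I_n) : exterior R n := ebasis [set i].

Definition homog (k : nat) al : Prop := forall S, al S != 0 -> #|S| = k.

(* For disjoint S and T: f^S /\ f^T = shuffle_sgn S T f^(S :|: T). *)
Definition shuffle_sgn S T : R :=
  (-1) ^+ #|[set p : 'I_n * 'I_n | [&& p.1 \in S, p.2 \in T & (p.2 < p.1)%N]]|.

Definition wedge al be : exterior R n :=
  [ffun S : {set 'I_n} => \sum_(T : {set 'I_n} | T \subset S)
     shuffle_sgn T (S :\: T) * al T * be (S :\: T)].

(* v _| f^{s_1 ... s_k} = sum_j (-1)^(j-1) v_{s_j} f^{s_1 ... ^s_j ... s_k} *)
Definition contract v al : exterior R n :=
  [ffun S : {set 'I_n} => \sum_(i : 'I_n | i \notin S)
     shuffle_sgn [set i] S * v 0 i * al (i |: S)].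

Definition wedge_seq (s : seq 'I_n) : exterior R n :=
  foldr (fun i => wedge (covec i)) (ebasis set0) s.

(* The Chevalley-Eilenberg differential of the Lie bracket br: on 1-forms,
   d f^k (f_i, f_j) = - f^k [f_i, f_j]; on monomials it is given by the graded
   Leibniz rule d(f^i /\ al) = d f^i /\ al - f^i /\ d al, where f^S is
   wedge_seq (enum S) by wedge_seq_enum below. *)
Section ChevalleyEilenberg.
Variable br : 'rV[R]_n -> 'rV[R]_n -> 'rV[R]_n.

Definition d_covec (k : 'I_n) : exterior R n :=
  \sum_(i < n) \sum_(j < n | (i < j)%N)
     (- br (delta_mx 0 i) (delta_mx 0 j) 0 k) *: wedge (covec i) (covec j).

Fixpoint d_wedge_seq (s : seq 'I_n) : exterior R n :=
  if s is i :: s' then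
    wedge (d_covec i) (wedge_seq s') - wedge (covec i) (d_wedge_seq s')
  else 0.

Definition dCE al : exterior R n := \sum_S al S *: d_wedge_seq (enum S).

End ChevalleyEilenberg.

(* Bilinear forms on V are given by their Gram matrix in the basis f_i. *)
Definition bilin (g : 'M[R]_n) v w : R := (v *m g *m w^T) 0 0.

Definition inner_product (g : 'M[R]_n) : Prop :=
  g^T = g /\ forall v, v != 0 -> 0 < bilin g v v.

(* <f^S, f^T> = det (g^{-1} (f^{s_i}, f^{t_j}))_{ij}; the default value of nth
   is never reached. *)
Definition gram_minor (g : 'M[R]_n) S T : R :=
  if #|S| == #|T| then
    \det (\matrix_(i < #|S|, j < #|S|)
            invmx g (enum_val i) (nth (enum_val i) (enum T) j))
  else 0.

Definition form_inner (g : 'M[R]_n) al be : R :=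
  \sum_S \sum_T al S * be T * gram_minor g S T.

(* The two values of o correspond to the two orientations of V. *)
Definition volume_form (g : 'M[R]_n) om : Prop :=
  exists o : bool, om = ((-1) ^+ o * Num.sqrt (\det g)) *: ebasis setT.

(* Characterized by al /\ *be = <al, be> om for al, be of the same degree, see
   wedge_hodge below. *)
Definition hodge (g : 'M[R]_n) om be : exterior R n :=
  [ffun T : {set 'I_n} =>
     shuffle_sgn (~: T) T * form_inner g (ebasis (~: T)) be * om setT].

End Exterior.

Section ExteriorTheory.
Variables (R : realType) (n : nat).
Implicit Types (al be om : exterior R n) (S T : {set 'I_n}) (v w : 'rV[R]_n).

Lemma shuffle_sgnK S T : shuffle_sgn R S T * shuffle_sgn R S T = 1.
Proof. by rewrite -expr2 sqrr_sign. Qed.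

Lemma wedge_ebasis S T : [disjoint S & T] ->
  wedge (ebasis R S) (ebasis R T) =
    shuffle_sgn R S T *: ebasis R (S :|: T).
Proof.
move=> dST; apply/ffunP => U; rewrite !ffunE; set c := shuffle_sgn R S T.
have [->|nU] := eqVneq U (S :|: T).
  have DE : (S :|: T) :\: S = T.
    by rewrite setDUl setDv set0U; apply/setDidPl; rewrite disjoint_sym.
  rewrite (bigD1 S) ?subsetUl //= !ffunE DE !eqxx !mulr1 big1 ?addr0.
    by rewrite /GRing.scale /= mulr1.
  by move=> X /andP[_ /negPf nX]; rewrite !ffunE nX mulr0 mul0r.
rewrite scaler0 big1 // => X sXU; rewrite !ffunE.
have [eX|] := eqVneq X S; last by rewrite mulr0 mul0r.
have [eT|] := eqVneq (U :\: X) T; last by rewrite mulr0.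
by case/eqP: nU; rewrite -eT -eX -{1}(setID U X) (setIidPr sXU).
Qed.

Lemma wedge_seq_enum S : wedge_seq R (enum S) = ebasis R S.
Proof.
have: sorted (fun i j : 'I_n => (i < j)%N) (enum S).
  have tr : transitive (fun i j : 'I_n => (i < j)%N).
    by move=> y x z; apply: ltn_trans.
  apply: (sorted_filter tr).
  rewrite -(@sorted_map _ _ (fun i : 'I_n => (i : nat)) ltn) -enumT val_enum_ord.
  exact: iota_ltn_sorted.
have {3}<-: [set x in enum S] = S by apply/setP => x; rewrite inE mem_enum.
elim: (enum S) => [|i s IH] /=.
  by move=> _; congr (ebasis R _); apply/setP => x; rewrite !inE.
rewrite path_sortedE; last by move=> y x z; apply: ltn_trans.
move=> /andP[/allP lti srt].
rewrite (IH srt) wedge_ebasis; last first.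
  rewrite disjoints1 inE; apply/negP => /lti; by rewrite ltnn.
rewrite /shuffle_sgn (_ : [set p : 'I_n * 'I_n | _] = set0); last first.
  apply/setP => -[x y]; rewrite !inE /=; apply/and3P => -[/eqP -> /lti].
  by move=> /ltnW; rewrite leqNgt => /negPf ->.
rewrite cards0 scale1r; congr (ebasis R _).
by apply/setP => x; rewrite !inE.
Qed.

Lemma form_inner_ebasisl g S be :
  form_inner g (ebasis R S) be = \sum_T be T * gram_minor g S T.
Proof.
rewrite /form_inner (bigD1 S) //= [X in _ + X]big1 ?addr0 => [|X /negPf nX].
  by apply: eq_bigr => T _; rewrite ffunE eqxx mul1r.
by apply: big1 => T _; rewrite ffunE nX !mul0r.
Qed.

Lemma form_inner_ebasis_neq0 k g S be : homog k be ->
  form_inner g (ebasis R S) be != 0 -> #|S| = k.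
Proof.
move=> hb; apply: contraNeq => nk; rewrite form_inner_ebasisl big1 // => T _.
have [->|/hb kT] := eqVneq (be T) 0; first by rewrite mul0r.
by rewrite /gram_minor kT (negPf nk) mulr0.
Qed.

Lemma wedge_hodge k g om al be :
  homog n om -> homog k al -> homog k be ->
  wedge al (hodge g om be) = form_inner g al be *: om.
Proof.
move=> hom hal hbe; apply/ffunP => U; rewrite !ffunE.
have [->|nU] := eqVneq U setT.
  rewrite /form_inner /GRing.scale /= mulr_suml.
  rewrite (eq_bigl xpredT) => [|T]; last by rewrite subsetT.
  apply: eq_bigr => T _; rewrite ffunE setTD setCK form_inner_ebasisl.
  set x := al T; set c := shuffle_sgn _ _ _; set s := \sum_(_ | _) _.
  have -> : c * x * (c * s * om setT) = (c * c) * (x * s * om setT).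
    by rewrite !mulrA; congr (_ * _ * _); rewrite mulrAC.
  rewrite shuffle_sgnK mul1r /s mulr_sumr; congr (_ * _).
  by apply: eq_bigr => T' _; rewrite mulrA.
have -> : om U = 0.
  apply/eqP; apply: contraNT nU => /hom kU.
  by rewrite eqEcard subsetT cardsT card_ord kU leqnn.
rewrite /GRing.scale /= mulr0 big1 // => T sTU; rewrite ffunE.
have [->|/hal kT] := eqVneq (al T) 0; first by rewrite mulr0 mul0r.
set x := form_inner _ _ _; have [->|] := eqVneq x 0.
  by rewrite !(mulr0, mul0r).
move/(form_inner_ebasis_neq0 hbe) => kC; case/eqP: nU; apply/eqP.
have := cardsC (U :\: T); rewrite kC cardsD (setIidPr sTU) kT card_ord.
rewrite subnK -?kT ?subset_leq_card // => kU.
by rewrite eqEcard subsetT cardsT card_ord kU leqnn.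
Qed.

Lemma homog_volume g om : volume_form g om -> homog n om.
Proof.
case=> o -> S; rewrite !ffunE; have [->|_] := eqVneq S setT.
  by rewrite cardsT card_ord.
by rewrite scaler0 eqxx.
Qed.

Lemma bilin_delta (g : 'M[R]_n) i j :
  bilin g (delta_mx 0 i) (delta_mx 0 j) = g i j.
Proof. by rewrite /bilin -rowE trmx_delta -colE !mxE. Qed.

Lemma inner_product_det_gt0 (g : 'M[R]_n) : inner_product g -> 0 < \det g.
Proof.
move=> [_ pg].
have nz t : 0 <= t -> \det ((1 - t)%:M + t *: g) = 0 -> 1 < t.
  rewrite le_eqVlt => /predU1P[<-|t0].
    by rewrite subr0 scale0r addr0 det1 => /eqP; rewrite oner_eq0.
  move=> /eqP/det0P[v v0 vM]; rewrite ltNge; apply/negP => t1.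
  have : (v *m ((1 - t)%:M + t *: g) *m v^T) 0 0 = 0 by rewrite vM mul0mx mxE.
  rewrite mulmxDr mulmxDl -scalemxAr -scalemxAl mul_mx_scalar -scalemxAl.
  rewrite mxE [X in X + _]mxE [X in _ + X]mxE => /eqP; apply/negP.
  rewrite gt_eqF // ltr_wpDl //; last by rewrite mulr_gt0 // (pg _ v0).
  rewrite mulr_ge0 ?subr_ge0 // mxE sumr_ge0 // => i _.
  by rewrite !mxE -expr2 sqr_ge0.
rewrite ltNge; apply/negP => d0.
pose M := (1 - 'X)%:M + 'X *: map_mx polyC g.
have ME t : (\det M).[t] = \det ((1 - t)%:M + t *: g).
  rewrite -[_.[t]]/(horner_eval t _) -det_map_mx; congr determinant.
  by apply/matrixP => i j; rewrite !mxE /= /horner_eval !(hornerE, hornerMn).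
have [|t /andP[t0 t1]] := @poly_ivt _ (- \det M) 0 1 ler01.
  by rewrite !hornerN !ME subr0 subrr scale0r addr0 det1 scale1r
             (_ : 0%:M = 0) ?add0r ?oppr_le0 ?oppr_ge0 ?ler01 // raddf0.
by rewrite rootN => /rootP; rewrite ME => /(nz _ t0); rewrite ltNge t1.
Qed.

Lemma expr_odd_inj m : odd m -> injective (fun x : R => x ^+ m).
Proof.
move=> om.
have m0 : (0 < m)%N by case: m om.
move=> x y /= xy; have [x0|x0] := leP 0 x.
  have y0 : 0 <= y by rewrite -(exprn_odd_ge0 _ om) -xy exprn_odd_ge0.
  by apply: (pexpIrn m0).
have y0 : y < 0 by rewrite -(exprn_odd_lt0 _ om) -xy exprn_odd_lt0.
apply: oppr_inj; apply: (pexpIrn m0); rewrite ?nnegrE ?oppr_ge0 ?ltW //.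
by rewrite exprNn xy -exprNn.
Qed.

Lemma wedge1r (al : exterior R n) : wedge al (ebasis R set0) = al.
Proof.
apply/ffunP => S; rewrite ffunE (bigD1 S) //= ffunE setDv eqxx mulr1.
rewrite big1 ?addr0 => [|T /andP[sTS nTS]].
  rewrite /shuffle_sgn (_ : [set p : 'I_n * 'I_n | _] = set0) ?cards0 ?mul1r //.
  by apply/setP => -[x y]; rewrite !inE andbF.
rewrite ffunE setD_eq0; have [sST|] := boolP (S \subset T); last by rewrite mulr0.
by case/eqP: nTS; apply/eqP; rewrite eqEsubset sTS.
Qed.

Lemma wedge0r (al : exterior R n) : wedge al 0 = 0.
Proof. by apply/ffunP => S; rewrite !ffunE big1 // => T _; rewrite ffunE mulr0. Qed.

Lemma dCE_covec br (k : 'I_n) : dCE br (covec R k) = d_covec br k.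
Proof.
rewrite /dCE (bigD1 [set k]) //= big1 => [|S /negPf nS]; last first.
  by rewrite ffunE nS scale0r.
by rewrite ffunE eqxx scale1r enum_set1 /= wedge1r wedge0r subr0 addr0.
Qed.

End ExteriorTheory.

Section G2.
Variable R : realType.
Implicit Types (phi om : exterior R 7) (g : 'M[R]_7).

Definition G2_structure phi : Prop :=
  homog 3 phi /\
  forall v : 'rV[R]_7, v != 0 ->
    wedge (wedge (contract v phi) (contract v phi)) phi != 0.

(* g = g_phi and om = vol_phi; the pair (g, om) is determined by phi, see
   G2_metric_vol_unique below. *)
Definition G2_metric_vol phi g om : Prop :=
  [/\ inner_product g, volume_form g om &
      forall v w : 'rV[R]_7,
        bilin g v w *: om =
          6%:R^-1 *: wedge (wedge (contract v phi) (contract w phi)) phi].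

Definition induces phi g : Prop := exists om, G2_metric_vol phi g om.

Definition purely_coclosed (br : 'rV[R]_7 -> 'rV[R]_7 -> 'rV[R]_7) phi : Prop :=
  exists g om, [/\ G2_metric_vol phi g om,
                   dCE br (hodge g om phi) = 0 &
                   wedge (dCE br phi) phi = 0].

Lemma G2_metric_vol_unique (phi : exterior R 7) g g' om om' :
  G2_metric_vol phi g om -> G2_metric_vol phi g' om' -> g = g' /\ om = om'.
Proof.
case=> [ig [o ->] Hg] [ig' [o' ->] Hg'].
set c := _ * _ in Hg *; set c' := _ * _ in Hg' *.
have E : c *: g = c' *: g'.
  apply/matrixP => i j; rewrite !mxE -!bilin_delta.
  have /ffunP/(_ setT) := etrans (Hg (delta_mx 0 i) (delta_mx 0 j)) (esym (Hg' _ _)).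
  by rewrite !ffunE eqxx /GRing.scale /= !mulr1 mulrC [RHS]mulrC.
have sq (h : 'M[R]_7) (p : bool) : inner_product h ->
    ((-1) ^+ p * Num.sqrt (\det h)) ^+ 2 = \det h.
  move=> /inner_product_det_gt0 ph.
  by rewrite exprMn sqrr_sign mul1r sqr_sqrtr // ltW.
have cE : c = c'.
  apply: (@expr_odd_inj R 9) => //=.
  by rewrite !(exprD _ 7 2) /c sq // -/c /c' sq // -/c' -!detZ E.
split; last by rewrite cE.
apply: (scalerI (a := c)); last by rewrite E cE.
by rewrite -sqrf_eq0 sq // gt_eqF // inner_product_det_gt0.
Qed.

End G2.

Definition i1 : 'I_7 := @Ordinal 7 0 isT.
Definition i2 : 'I_7 := @Ordinal 7 1 isT.
Definition i3 : 'I_7 := @Ordinal 7 2 isT.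
Definition i4 : 'I_7 := @Ordinal 7 3 isT.
Definition i5 : 'I_7 := @Ordinal 7 4 isT.
Definition i6 : 'I_7 := @Ordinal 7 5 isT.
Definition i7 : 'I_7 := @Ordinal 7 6 isT.

Section H3H3R.
Variable R : realType.
Implicit Types (v w : 'rV[R]_7) (i j : 'I_7).

Definition fvec i : 'rV[R]_7 := delta_mx 0 i.

(* [f_1, f_2] = - f_5 and [f_3, f_4] = - f_6, i.e. d f^5 = f^12 and
   d f^6 = f^34, see d_h3h3R below. *)
Definition h3h3R_br v w : 'rV[R]_7 :=
  - (v 0 i1 * w 0 i2 - v 0 i2 * w 0 i1) *: fvec i5
  - (v 0 i3 * w 0 i4 - v 0 i4 * w 0 i3) *: fvec i6.

Lemma d_h3h3R (k : 'I_7) :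
  dCE h3h3R_br (covec R k) =
    if k == i5 then wedge (covec R i1) (covec R i2)
    else if k == i6 then wedge (covec R i3) (covec R i4) else 0.
Proof.
rewrite dCE_covec.
have brE (i j : 'I_7) : (i < j)%N ->
    - h3h3R_br (delta_mx 0 i) (delta_mx 0 j) 0 k =
      ((i == i1) && (j == i2) && (k == i5))%:R
      + ((i == i3) && (j == i4) && (k == i6))%:R :> R.
  move=> ij; have e0 (p q : 'I_7) : (q < p)%N ->
      (p == i)%:R * (q == j)%:R = 0 :> R.
    move=> pq; rewrite -natrM mulnb; case: andP => // -[/eqP pi /eqP qj].
    by move: pq; rewrite pi qj ltnNge ltnW.
  rewrite !mxE !eqxx /= (e0 i2 i1) // (e0 i4 i3) // !subr0 opprB mulNr.
  rewrite opprK addrC -!natrM !mulnb.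
  by rewrite (eq_sym i1) (eq_sym i2) (eq_sym i3) (eq_sym i4).
have sumE (p q : 'I_7) (b : bool) : (p < q)%N ->
    \sum_(i < 7) \sum_(j < 7 | (i < j)%N)
      ((i == p) && (j == q) && b)%:R *: wedge (covec R i) (covec R j) =
    b%:R *: wedge (covec R p) (covec R q).
  move=> pq; rewrite (bigD1 p) //= (bigD1 q) //= !eqxx /=.
  rewrite !big1 ?addr0 // => [i /negPf ni|j /andP[_ /negPf nj]].
    by rewrite big1 // => j _; rewrite ni scale0r.
  by rewrite nj scale0r.
rewrite /d_covec.
under eq_bigr => i _ do under eq_bigr => j ij do rewrite brE // scalerDl.
under eq_bigr => i _ do rewrite big_split /=.
rewrite big_split /= !sumE //.
have [->|] := eqVneq k i5; first by rewrite scale1r scale0r addr0.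
by move=> _; case: eqP; rewrite scale0r add0r ?scale1r ?scale0r.
Qed.

Definition ideal1 : {vspace 'rV[R]_7} := <<[:: fvec i1; fvec i2; fvec i5]>>%VS.
Definition ideal2 : {vspace 'rV[R]_7} := <<[:: fvec i3; fvec i4; fvec i6]>>%VS.
Definition ideal3 : {vspace 'rV[R]_7} := <<[:: fvec i7]>>%VS.

Definition orthogonal_spaces (g : 'M[R]_7) (U W : {vspace 'rV[R]_7}) : Prop :=
  forall v w, v \in U -> w \in W -> bilin g v w = 0.

Definition orthogonal_decomposition (g : 'M[R]_7) : Prop :=
  [/\ orthogonal_spaces g ideal1 ideal2, orthogonal_spaces g ideal1 ideal3 &
      orthogonal_spaces g ideal2 ideal3].

(* Gram matrix of the symmetric product of f^i and f^j *)
Definition sprod i j : 'M[R]_7 := 2%:R^-1 *: (delta_mx i j + delta_mx j i).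

Definition metric (a b E F G : R) : 'M[R]_7 :=
  sprod i1 i1 + sprod i2 i2 + sprod i3 i3 + sprod i4 i4
  + (2%:R * a) *: sprod i1 i3 + (2%:R * b) *: sprod i2 i4
  + E *: sprod i5 i5 + (2%:R * F) *: sprod i5 i6 + G *: sprod i6 i6
  + sprod i7 i7.

End H3H3R.

(* Main.v *)
(* Write u_i for the vector dual to f^i under g, and * for the cross product of
   phi, g(x * y, z) = phi(x, y, z). Contracting the definition of g_phi twice
   shows that (v _| phi) /\ phi is, up to a constant, Hodge dual to v _| phi and
   that |x * y|^2 is proportional to |x|^2 |y|^2 - g(x, y)^2. Since the image of
   d on 2-forms is spanned by f^12j, f^34j (j = 1, 2, 3, 4, 7) and
   f^126 - f^345, coclosedness says that X = u_1 * u_2 and Y = u_3 * u_4 are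
   X = p f_5 + q f_6 and Y = q f_5 + r f_6; pureness says pE + 2qF + rG = 0.
   Comparing |X|^2, |Y|^2 and g(X, Y) gives G = E and -F/E as the cosine of the
   angle between X and Y. Moreover X * Y is a multiple of f_7, so X * u_3 lies in
   the span of u_1, ..., u_4, and its Gram relations read
   (-F/E - ab)^2 = (1 - a^2)(1 - b^2); when the decomposition is orthogonal they
   contradict X * u_3 <> 0. Conversely, an orthonormal coframe with X and Y
   along f_5 and f_6 carries an explicit solution. *)

Require Import Defs.
From mathcomp Require Import all_boot all_order all_algebra.
From mathcomp Require Import reals.
From mathcomp Require Import ring lra.
Set Implicit Arguments.
Unset Strict Implicit.
Unset Printing Implicit Defensive.
Import Order.TTheory GRing.Theory Num.Theory.
Local Open Scope ring_scope.

(** * Exterior algebra *)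

(** Everything about the cross product is extracted from the defining identity of g_phi. The
    alternation of the dual trilinear form and the norm of x * y are therefore derived, and a
    positive factor [mu] is carried along. The relations between X and Y are a trace argument. Let M
    be the symmetric matrix with entries p, q, r and S the Gram matrix of f_5, f_6. Pureness is
    tr(MS) = 0, so Cayley-Hamilton gives MSM = -det(M) adj(S), and MSM is the Gram matrix of X, Y. X
    * Y is a multiple of f_7 because u_1 * X and u_2 * X lie in the span of u_1, u_2, which is
    orthogonal to Y, and likewise with u_3, u_4, Y and X exchanged; this makes X * Y orthogonal to
    u_1, ..., u_4, and it is orthogonal to X and Y anyway. With a = cos(alpha) and b = cos(beta),
    the two values of the cosine -F/E are cos(alpha - eps beta) for eps = 1 and -1. The explicit
    solution also uses s = -sin(alpha - eps beta), which has to be nonzero. *)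

Section SetSplit.
Variable n : nat.
Implicit Types S T : {set 'I_n}.

(** Subsets of an (n+1)-element index set are split by whether they contain the first index, so that
    identities between forms can be proved by induction on the dimension. *)
Definition up S : {set 'I_n.+1} := lift ord0 @: S.
Definition up1 S : {set 'I_n.+1} := ord0 |: up S.

Lemma in_up S i : (lift ord0 i \in up S) = (i \in S).
Proof. exact/mem_imset/lift_inj. Qed.

Lemma in_up0 S : (ord0 \in up S) = false.
Proof. by apply/negP => /imsetP[i _ /eqP]; rewrite (negPf (neq_lift _ _)). Qed.

Lemma in_up1 S i : (lift ord0 i \in up1 S) = (i \in S).
Proof. by rewrite !inE in_up eq_sym (negPf (neq_lift _ _)). Qed.

Lemma in_up10 S : (ord0 \in up1 S).
Proof. by rewrite !inE eqxx. Qed.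

Definition in_upE := (in_up, in_up0, in_up1, in_up10).

Lemma up_ext (A B : {set 'I_n.+1}) :
  (ord0 \in A) = (ord0 \in B) ->
  (forall i : 'I_n, (lift ord0 i \in A) = (lift ord0 i \in B)) -> A = B.
Proof. by move=> h0 h1; apply/setP => i; case: (unliftP ord0 i) => [j|] ->. Qed.

Lemma sub_ext (A B : {set 'I_n.+1}) :
  (A \subset B) = ((ord0 \in A) ==> (ord0 \in B)) &&
    [forall i : 'I_n, (lift ord0 i \in A) ==> (lift ord0 i \in B)].
Proof.
apply/subsetP/andP => [h|[/implyP h0 /forallP h1] i].
  by split; [apply/implyP/h|apply/forallP => i; apply/implyP/h].
by case: (unliftP ord0 i) => [j|] ->; [exact/implyP/h1|].
Qed.

Lemma sub_forall S T : [forall i, (i \in S) ==> (i \in T)] = (S \subset T).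
Proof.
by apply/forallP/subsetP => h i; [apply/implyP|apply/implyP]; exact: h.
Qed.

Lemma sub_up S T : (up S \subset up T) = (S \subset T).
Proof. by rewrite sub_ext !in_upE /=; under eq_forallb do rewrite !in_upE; rewrite sub_forall. Qed.

Lemma sub_up1 S T : (up1 S \subset up T) = false.
Proof. by rewrite sub_ext !in_upE. Qed.

Lemma sub_upup1 S T : (up S \subset up1 T) = (S \subset T).
Proof. by rewrite sub_ext !in_upE /=; under eq_forallb do rewrite !in_upE; rewrite sub_forall. Qed.

Lemma sub_up1up1 S T : (up1 S \subset up1 T) = (S \subset T).
Proof. by rewrite sub_ext !in_upE /=; under eq_forallb do rewrite !in_upE; rewrite sub_forall. Qed.

Lemma upD S T : up S :\: up T = up (S :\: T).
Proof. by apply: up_ext => [|i]; rewrite !inE !in_upE ?inE. Qed.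

Lemma up1D S T : up1 S :\: up T = up1 (S :\: T).
Proof. by apply: up_ext => [|i]; rewrite in_setD !in_upE ?in_setD. Qed.

Lemma up1Dup1 S T : up1 S :\: up1 T = up (S :\: T).
Proof. by apply: up_ext => [|i]; rewrite in_setD !in_upE ?in_setD. Qed.

Lemma upU1 S i : lift ord0 i |: up S = up (i |: S).
Proof. by rewrite /up imsetU1. Qed.

Lemma up1U1 S i : lift ord0 i |: up1 S = up1 (i |: S).
Proof. by rewrite /up1 /up imsetU1 setUCA. Qed.

Lemma card_up S : #|up S| = #|S|.
Proof. exact/card_imset/lift_inj. Qed.

Lemma card_up1 S : #|up1 S| = #|S|.+1.
Proof. by rewrite cardsU1 in_up0 card_up. Qed.

Lemma up0 : up set0 = set0.
Proof. exact: imset0. Qed.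

Lemma up_case (A : {set 'I_n.+1}) : A = if ord0 \in A then up1 (lift ord0 @^-1: A)
   else up (lift ord0 @^-1: A).
Proof.
by case: ifP => h; apply: up_ext => [|i]; rewrite !in_upE ?inE.
Qed.

Lemma big_up (R : nmodType) (P : pred {set 'I_n.+1}) (F : {set 'I_n.+1} -> R) :
  \sum_(T | P T) F T =
    \sum_(S : {set 'I_n} | P (up S)) F (up S) + \sum_(S : {set 'I_n} | P (up1 S)) F (up1 S).
Proof.
rewrite (bigID [pred T : {set 'I_n.+1} | ord0 \notin T]) /=; congr (_ + _).
  rewrite (reindex_onto up (fun T : {set 'I_n.+1} => lift ord0 @^-1: T)) /=; last first.
    by move=> T /andP[_ /negPf h]; rewrite [RHS]up_case h.
  apply: eq_bigl => S; rewrite in_up0 andbT [X in _ && X](_ : _ = true) ?andbT //.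
  by apply/eqP/setP => i; rewrite inE in_up.
rewrite (reindex_onto up1 (fun T : {set 'I_n.+1} => lift ord0 @^-1: T)) /=; last first.
  by move=> T /andP[_]; rewrite negbK => h; rewrite [RHS]up_case h.
apply: eq_bigl => S; rewrite in_up10 andbT [X in _ && X](_ : _ = true) ?andbT //.
by apply/eqP/setP => i; rewrite inE in_up1.
Qed.

End SetSplit.

(** * Wedge product and contraction by recursion on the dimension *)

Section Exterior.
Variable R : realType.

(** As a double sum, the inversion count lets the first index be peeled off by [big_ord_recl]. *)
Lemma shuffle_sgnE n (S T : {set 'I_n}) :
  shuffle_sgn R S T =
  (-1) ^+ (\sum_(i < n) \sum_(j < n) [&& i \in S, j \in T & (j < i)%N]).
Proof.
rewrite /shuffle_sgn -sum1_card pair_big_dep /=.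
rewrite [in RHS](bigID [pred p : 'I_n * 'I_n | [&& p.1 \in S, p.2 \in T & (p.2 < p.1)%N]]) /=.
rewrite [X in (_ + X)%N]big1 ?addn0 => [|p /negPf -> //].
by congr (_ ^+ _); apply: eq_big => p; rewrite ?inE // => ->.
Qed.

Section Rec.
Variable n : nat.
Implicit Types (S T : {set 'I_n}) (al be : exterior R n.+1) (v : 'rV[R]_n.+1).

Lemma sgn_up S T : shuffle_sgn R (up S) (up T) = shuffle_sgn R S T.
Proof.
rewrite !shuffle_sgnE big_ord_recl big1 ?add0n => [|j _]; last by rewrite in_up0.
congr (_ ^+ _); apply: eq_bigr => i _; rewrite big_ord_recl in_up0 andbF add0n.
by apply: eq_bigr => j _; rewrite !in_upE /= /bump /= !add1n.
Qed.

Lemma sgn_up1l S T : shuffle_sgn R (up1 S) (up T) = shuffle_sgn R S T.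
Proof.
rewrite !shuffle_sgnE big_ord_recl big1 ?add0n => [|j _]; last by rewrite ltn0 !andbF.
congr (_ ^+ _); apply: eq_bigr => i _; rewrite big_ord_recl in_up0 andbF add0n.
by apply: eq_bigr => j _; rewrite !in_upE /= /bump /= !add1n.
Qed.

(** The new smallest index of the second set is inverted with every element of the first. *)
Lemma sgn_up1r S T : shuffle_sgn R (up S) (up1 T) = (-1) ^+ #|S| * shuffle_sgn R S T.
Proof.
rewrite !shuffle_sgnE big_ord_recl big1 ?add0n => [|j _]; last by rewrite in_up0.
rewrite -exprD; congr (_ ^+ _).
rewrite -sum1_card [X in (X + _)%N]big_mkcond -big_split /=; apply: eq_bigr => i _.
rewrite big_ord_recl; congr (_ + _)%N; first by rewrite !in_upE /= andbT; case: (_ \in _).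
by apply: eq_bigr => j _; rewrite !in_upE /= /bump /= !add1n.
Qed.

(* [al = lo al + f^0 /\ hi al], with the indices of both parts shifted by one. *)
Definition lo al : exterior R n := [ffun S => al (up S)].
Definition hi al : exterior R n := [ffun S => al (up1 S)].

Lemma ext_lohi al be : lo al = lo be -> hi al = hi be -> al = be.
Proof.
move=> /ffunP l /ffunP h; apply/ffunP => S; rewrite (up_case S).
by case: ifP => _; [have := h (lift ord0 @^-1: S)|have := l (lift ord0 @^-1: S)];
  rewrite !ffunE.
Qed.

End Rec.

(** The grade involution. It carries the sign of the graded Leibniz rules, which can then be stated
    for forms of mixed degree. *)
Definition ginv n (al : exterior R n) : exterior R n :=
  [ffun S : {set 'I_n} => (-1) ^+ #|S| * al S].

Lemma shuffle_sgn_0 (S T : {set 'I_0}) : shuffle_sgn R S T = 1.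
Proof. by rewrite shuffle_sgnE big_ord0. Qed.

Lemma set_I0 (S : {set 'I_0}) : S = set0.
Proof. by apply/setP => -[]. Qed.

Lemma wedge_I0 (al be : exterior R 0) S : wedge al be S = al set0 * be set0.
Proof.
rewrite ffunE (eq_bigl (pred1 set0)) => [|T]; last by rewrite (set_I0 T) sub0set inE eqxx.
by rewrite big_pred1_eq shuffle_sgn_0 mul1r [_ :\: _]set_I0.
Qed.

Lemma contract_I0 v (al : exterior R 0) : contract v al = 0.
Proof. by apply/ffunP => S; rewrite !ffunE big_ord0. Qed.

Lemma ext_I0 (al be : exterior R 0) : al set0 = be set0 -> al = be.
Proof. by move=> h; apply/ffunP => S; rewrite (set_I0 S). Qed.

Section RecLin.
Variable n : nat.
Implicit Types (al be : exterior R n.+1) (v : 'rV[R]_n.+1) (c : R).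

Lemma loD al be : lo (al + be) = lo al + lo be.
Proof. by apply/ffunP => S; rewrite !ffunE. Qed.
Lemma hiD al be : hi (al + be) = hi al + hi be.
Proof. by apply/ffunP => S; rewrite !ffunE. Qed.
Lemma loN al : lo (- al) = - lo al.
Proof. by apply/ffunP => S; rewrite !ffunE. Qed.
Lemma hiN al : hi (- al) = - hi al.
Proof. by apply/ffunP => S; rewrite !ffunE. Qed.
Lemma lo0 : lo (0 : exterior R n.+1) = 0.
Proof. by apply/ffunP => S; rewrite !ffunE. Qed.
Lemma hi0 : hi (0 : exterior R n.+1) = 0.
Proof. by apply/ffunP => S; rewrite !ffunE. Qed.
Lemma lo_ginv al : lo (ginv al) = ginv (lo al).
Proof. by apply/ffunP => S; rewrite !ffunE card_up. Qed.
Lemma hi_ginv al : hi (ginv al) = - ginv (hi al).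
Proof. by apply/ffunP => S; rewrite !ffunE card_up1 exprS mulN1r mulNr. Qed.

Lemma lo_wedge al be : lo (wedge al be) = wedge (lo al) (lo be).
Proof.
apply/ffunP => S; rewrite !ffunE big_up [X in _ + X]big1 => [|T]; last by rewrite sub_up1.
rewrite addr0; apply: eq_big => T; first by rewrite sub_up.
by move=> _; rewrite upD sgn_up !ffunE.
Qed.

Lemma hi_wedge al be :
  hi (wedge al be) = wedge (hi al) (lo be) + wedge (ginv (lo al)) (hi be).
Proof.
apply/ffunP => S; rewrite !ffunE big_up addrC; congr (_ + _).
  apply: eq_big => T; first by rewrite sub_up1up1.
  by move=> _; rewrite up1Dup1 sgn_up1l !ffunE.
apply: eq_big => T; first by rewrite sub_upup1.
by move=> _; rewrite up1D sgn_up1r !ffunE mulrA [_ * shuffle_sgn _ _ _]mulrC -!mulrA.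
Qed.

Definition lov v : 'rV[R]_n := \row_j v 0 (lift ord0 j).

Lemma up_set1 (i : 'I_n) : [set lift ord0 i] = up [set i].
Proof. by rewrite /up imset_set1. Qed.

Lemma set1_up1 : [set ord0] = up1 set0 :> {set 'I_n.+1}.
Proof. by rewrite /up1 up0 setU0. Qed.

Lemma sgn0 (S : {set 'I_n}) : shuffle_sgn R set0 S = 1.
Proof. by rewrite shuffle_sgnE big1 // => i _; rewrite big1 // => j _; rewrite inE. Qed.

Lemma lo_contract v al :
  lo (contract v al) = contract (lov v) (lo al) + v 0 ord0 *: hi al.
Proof.
apply/ffunP => S; rewrite !ffunE big_mkcond big_ord_recl /= in_up0 /= addrC.
rewrite set1_up1 sgn_up1l sgn0 mul1r; congr (_ + _); last by rewrite -set1_up1.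
rewrite [RHS]big_mkcond; apply: eq_bigr => i _.
by rewrite in_up mxE !ffunE upU1 up_set1 sgn_up.
Qed.

Lemma hi_contract v al : hi (contract v al) = - contract (lov v) (hi al).
Proof.
apply/ffunP => S; rewrite !ffunE big_mkcond big_ord_recl /= in_up10 /= add0r.
rewrite [X in - X]big_mkcond -sumrN; apply: eq_bigr => i _.
rewrite in_up1 !ffunE up1U1 up_set1 sgn_up1r cards1 expr1 mxE.
by case: ifP; rewrite ?oppr0 // !mulNr mul1r.
Qed.

End RecLin.

Section Algebra.
Variable n : nat.
Implicit Types (al be ga : exterior R n) (v w : 'rV[R]_n) (c : R).

Lemma wedgeDl al be ga : wedge (al + be) ga = wedge al ga + wedge be ga.
Proof.
apply/ffunP => S; rewrite !ffunE -big_split; apply: eq_bigr => T _.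
by rewrite !ffunE mulrDr mulrDl.
Qed.

Lemma wedgeDr al be ga : wedge al (be + ga) = wedge al be + wedge al ga.
Proof.
by apply/ffunP => S; rewrite !ffunE -big_split; apply: eq_bigr => T _; rewrite !ffunE mulrDr.
Qed.

Lemma wedgeZl c al be : wedge (c *: al) be = c *: wedge al be.
Proof.
apply/ffunP => S; rewrite !ffunE [RHS]mulr_sumr; apply: eq_bigr => T _.
by rewrite !ffunE /GRing.scale /=; ring.
Qed.

Lemma wedgeZr c al be : wedge al (c *: be) = c *: wedge al be.
Proof.
apply/ffunP => S; rewrite !ffunE [RHS]mulr_sumr; apply: eq_bigr => T _.
by rewrite !ffunE /GRing.scale /=; ring.
Qed.

Lemma wedgeNl al be : wedge (- al) be = - wedge al be.
Proof. by rewrite -scaleN1r wedgeZl scaleN1r. Qed.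

Lemma wedgeNr al be : wedge al (- be) = - wedge al be.
Proof. by rewrite -scaleN1r wedgeZr scaleN1r. Qed.

Lemma wedge0l al : wedge 0 al = 0.
Proof. by rewrite -(scale0r 0) wedgeZl !scale0r. Qed.

Lemma wedge_suml (I : finType) (P : pred I) (F : I -> exterior R n) be :
  wedge (\sum_(i | P i) F i) be = \sum_(i | P i) wedge (F i) be.
Proof. by elim/big_rec2: _ => [|i x y _ <-]; rewrite ?wedge0l ?wedgeDl. Qed.

Lemma wedge_sumr (I : finType) (P : pred I) (F : I -> exterior R n) be :
  wedge be (\sum_(i | P i) F i) = \sum_(i | P i) wedge be (F i).
Proof. by elim/big_rec2: _ => [|i x y _ <-]; rewrite ?wedge0r ?wedgeDr. Qed.

Lemma contractDr v al be : contract v (al + be) = contract v al + contract v be.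
Proof.
by apply/ffunP => S; rewrite !ffunE -big_split; apply: eq_bigr => T _; rewrite !ffunE mulrDr.
Qed.

Lemma contractZr v c al : contract v (c *: al) = c *: contract v al.
Proof.
apply/ffunP => S; rewrite !ffunE [RHS]mulr_sumr; apply: eq_bigr => T _.
by rewrite !ffunE /GRing.scale /=; ring.
Qed.

Lemma contractNr v al : contract v (- al) = - contract v al.
Proof. by rewrite -scaleN1r contractZr scaleN1r. Qed.

Lemma contract0r v : contract v 0 = 0 :> exterior R n.
Proof. by rewrite -(scale0r 0) contractZr !scale0r. Qed.

Lemma contract_sumr (I : finType) (P : pred I) (F : I -> exterior R n) v :
  contract v (\sum_(i | P i) F i) = \sum_(i | P i) contract v (F i).
Proof. by elim/big_rec2: _ => [|i x y _ <-]; rewrite ?contract0r ?contractDr. Qed.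

Lemma contractDl v w al : contract (v + w) al = contract v al + contract w al.
Proof.
apply/ffunP => S; rewrite !ffunE -big_split; apply: eq_bigr => T _.
by rewrite !mxE mulrDr mulrDl.
Qed.

Lemma contractZl v c al : contract (c *: v) al = c *: contract v al.
Proof.
apply/ffunP => S; rewrite !ffunE [RHS]mulr_sumr; apply: eq_bigr => T _.
by rewrite !mxE; ring.
Qed.

Lemma ginvD al be : ginv (al + be) = ginv al + ginv be.
Proof. by apply/ffunP => S; rewrite !ffunE mulrDr. Qed.

Lemma ginvK al : ginv (ginv al) = al.
Proof. by apply/ffunP => S; rewrite !ffunE mulrA -expr2 sqrr_sign mul1r. Qed.

End Algebra.

Lemma wedge_ginv n (al be : exterior R n) : ginv (wedge al be) = wedge (ginv al) (ginv be).
Proof.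
elim: n => [|n IH] in al be *.
  apply: ext_I0; rewrite wedge_I0 [in LHS]ffunE wedge_I0 !ffunE cards0.
  by rewrite !expr0 !mul1r.
apply: ext_lohi; first by rewrite !(lo_wedge, lo_ginv) IH.
rewrite !(hi_wedge, hi_ginv, lo_wedge, lo_ginv) ginvD !IH opprD.
by rewrite wedgeNl wedgeNr.
Qed.

Lemma wedgeA n (al be ga : exterior R n) :
  wedge al (wedge be ga) = wedge (wedge al be) ga.
Proof.
elim: n => [|n IH] in al be ga *.
  by apply: ext_I0; rewrite !wedge_I0 mulrA.
apply: ext_lohi; first by rewrite !lo_wedge IH.
by rewrite !(hi_wedge, lo_wedge) wedgeDl wedgeDr !IH wedge_ginv addrA.
Qed.

(** The two parities need a joint induction, since passing to [hi] lowers the degree by one and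
    exchanges them. *)
Lemma wedge_even_odd n (al be : exterior R n) :
  (ginv al = al -> wedge al be = wedge be al) /\
  (ginv al = - al -> wedge al be = wedge (ginv be) al).
Proof.
elim: n => [|n IH] in al be *.
  split=> [_|/ffunP/(_ set0)]; first by apply: ext_I0; rewrite !wedge_I0 mulrC.
  rewrite !ffunE cards0 mul1r => /eqP; rewrite -addr_eq0 -mulr2n mulrn_eq0 /= => /eqP a0.
  by apply: ext_I0; rewrite !wedge_I0 a0 mul0r mulr0.
split=> h.
  have hl : ginv (lo al) = lo al by rewrite -lo_ginv h.
  have hh : ginv (hi al) = - hi al by rewrite -[LHS]opprK -hi_ginv h.
  apply: ext_lohi; first by rewrite !lo_wedge (IH _ _).1.
  by rewrite !hi_wedge hl (IH _ _).2 // [wedge (lo al) _](IH _ _).1 // addrC.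
have hl : ginv (lo al) = - lo al by rewrite -lo_ginv h loN.
have hh : ginv (hi al) = hi al by rewrite -[LHS]opprK -hi_ginv h hiN opprK.
apply: ext_lohi; first by rewrite !lo_wedge (IH _ _).2 // lo_ginv.
rewrite !hi_wedge hl (IH _ _).1 // wedgeNl [wedge (lo al) _](IH _ _).2 //.
by rewrite hi_ginv lo_ginv ginvK wedgeNl addrC.
Qed.

Lemma wedge_evenC n (al be : exterior R n) : ginv al = al -> wedge al be = wedge be al.
Proof. exact: (wedge_even_odd _ _).1. Qed.

Lemma wedge_oddC n (al be : exterior R n) : ginv al = - al ->
  wedge al be = wedge (ginv be) al.
Proof. exact: (wedge_even_odd _ _).2. Qed.

Lemma contract_ginv n v (al : exterior R n) : contract v (ginv al) = - ginv (contract v al).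
Proof.
apply/ffunP => S; rewrite !ffunE mulr_sumr -sumrN; apply: eq_bigr => i iS.
by rewrite !ffunE cardsU1 iS exprS; ring.
Qed.

Lemma contract_wedge n v (al be : exterior R n) :
  contract v (wedge al be) = wedge (contract v al) be + wedge (ginv al) (contract v be).
Proof.
elim: n => [|n IH] in v al be *.
  by rewrite !contract_I0 wedge0l wedge0r addr0.
apply: ext_lohi.
  rewrite !(loD, lo_wedge, lo_contract, lo_ginv, hi_wedge) IH wedgeDl wedgeDr.
  rewrite scalerDr wedgeZl wedgeZr -!addrA; congr (_ + _).
  by rewrite addrCA.
rewrite !(hiD, hi_wedge, lo_wedge, hi_contract, lo_contract, lo_ginv, hi_ginv).
rewrite contractDr !IH !(wedgeDl, wedgeDr, wedgeNl, wedgeNr, ginvK, contract_ginv, ginvD).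
rewrite !(wedgeNl, wedgeNr, wedgeZl, wedgeZr, opprK, opprD).
have gZ c (x : exterior R n) : ginv (c *: x) = c *: ginv x.
  by apply/ffunP => S; rewrite !ffunE /GRing.scale /= mulrCA.
rewrite gZ wedgeZl -!addrA; congr (_ + _).
set a := wedge (ginv (hi al)) _; set b := wedge (ginv (contract _ _)) _.
set c := wedge (lo al) _; set d : exterior R n := _ *: _.
by move: a b c d => a b c d; apply/ffunP => S; rewrite !ffunE; ring.
Qed.

Lemma contract2_eq0 n v (al : exterior R n) : contract v (contract v al) = 0.
Proof.
elim: n => [|n IH] in v al *; first exact: contract_I0.
apply: ext_lohi.
  by rewrite !(lo_contract, hi_contract) contractDr contractZr IH add0r scalerN subrr lo0.
by rewrite !hi_contract contractNr opprK IH hi0.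
Qed.

End Exterior.

(** * Homogeneous forms, covectors and evaluation of 3-forms *)

Section Forms.
Variables (R : realType) (n : nat).
Implicit Types (al be ga : exterior R n) (v w x y z : 'rV[R]_n) (c : R) (S T : {set 'I_n}).

Lemma ext_scaleE c al S : (c *: al) S = c * al S.
Proof. by rewrite ffunE. Qed.

Lemma ext_addE al be S : (al + be) S = al S + be S.
Proof. by rewrite ffunE. Qed.

Lemma ext_oppE al S : (- al) S = - al S.
Proof. by rewrite ffunE. Qed.

Lemma homog0 k : homog k (0 : exterior R n).
Proof. by move=> S; rewrite ffunE eqxx. Qed.

Lemma homogD k al be : homog k al -> homog k be -> homog k (al + be).
Proof.
move=> ha hb S; rewrite ffunE; have [->|/ha //] := eqVneq (al S) 0.
by rewrite add0r => /hb.
Qed.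

Lemma homogZ k c al : homog k al -> homog k (c *: al).
Proof. by move=> ha S; rewrite ffunE mulf_eq0 => /norP[_ /ha]. Qed.

Lemma homog_sum k (I : finType) (P : pred I) (F : I -> exterior R n) :
  (forall i, P i -> homog k (F i)) -> homog k (\sum_(i | P i) F i).
Proof. by move=> h; elim/big_ind: _ => //; [exact: homog0|exact: homogD]. Qed.

Lemma homog_ebasis S : homog #|S| (ebasis R S).
Proof. by move=> T; rewrite ffunE; have [->|_] := eqVneq T S; rewrite ?eqxx. Qed.

Lemma homog_covec (i : 'I_n) : homog 1 (covec R i).
Proof. by rewrite -(cards1 i); exact: homog_ebasis. Qed.

Lemma homog_wedge k l al be : homog k al -> homog l be -> homog (k + l) (wedge al be).
Proof.
move=> ha hb S; apply: contraNeq => h; rewrite ffunE big1 // => T sT.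
have [->|/ha kT] := eqVneq (al T) 0; first by rewrite mulr0 mul0r.
have [->|/hb kST] := eqVneq (be (S :\: T)) 0; first by rewrite mulr0.
by case/eqP: h; rewrite -(cardsID T S) (setIidPr sT) kT kST.
Qed.

Lemma homog_contract k v al : homog k.+1 al -> homog k (contract v al).
Proof.
move=> ha S; apply: contraNeq => h; rewrite ffunE big1 // => i iS.
have [->|/ha] := eqVneq (al (i |: S)) 0; first by rewrite mulr0.
by rewrite cardsU1 iS => -[kS]; case/eqP: h.
Qed.

Lemma ginv_homog k al : homog k al -> ginv al = (-1) ^+ k *: al.
Proof.
move=> ha; apply/ffunP => S; rewrite !ffunE.
by have [->|/ha ->] := eqVneq (al S) 0; rewrite ?scaler0 ?mulr0.
Qed.

Lemma ginv_even k al : homog k al -> ~~ odd k -> ginv al = al.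
Proof. by move=> /ginv_homog ->; rewrite -signr_odd => /negPf ->; rewrite scale1r. Qed.

Lemma ginv_odd k al : homog k al -> odd k -> ginv al = - al.
Proof. by move=> /ginv_homog ->; rewrite -signr_odd => ->; rewrite scaleN1r. Qed.

Lemma wedge1l al : wedge (ebasis R set0) al = al.
Proof.
by rewrite wedge_evenC ?wedge1r //; apply: (@ginv_even 0) => //; rewrite -(cards0 'I_n);
  apply: homog_ebasis.
Qed.

Lemma homog0E al : homog 0 al -> al = al set0 *: ebasis R set0.
Proof.
move=> h; apply/ffunP => S; rewrite !ffunE; have [->|nS] := eqVneq S set0.
  by rewrite /GRing.scale /= mulr1.
rewrite scaler0; apply/eqP; apply: contraNT nS => /h /eqP.
by rewrite cards_eq0.
Qed.

Lemma homog_topE al : homog n al -> al = al setT *: ebasis R setT.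
Proof.
move=> h; apply/ffunP => S; rewrite !ffunE; have [->|nS] := eqVneq S setT.
  by rewrite /GRing.scale /= mulr1.
rewrite scaler0; apply/eqP; apply: contraNT nS => /h kS.
by rewrite eqEcard subsetT cardsT card_ord kS leqnn.
Qed.

Definition pairing v w : R := \sum_i v 0 i * w 0 i.
Definition cov w : exterior R n := \sum_i w 0 i *: covec R i.

Lemma homog_cov w : homog 1 (cov w).
Proof. by apply: homog_sum => i _; apply/homogZ/homog_covec. Qed.

Lemma cov_coef w i : cov w [set i] = w 0 i.
Proof.
rewrite sum_ffunE (bigD1 i) //= big1 => [|j ji]; rewrite !ffunE.
  by rewrite eqxx addr0 /GRing.scale /= mulr1.
by rewrite (inj_eq set1_inj) eq_sym (negPf ji) scaler0.
Qed.

Lemma homog1E al : homog 1 al -> al = cov (\row_i al [set i]).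
Proof.
move=> h; apply/ffunP => S; have [/eqP/cards1P[i ->]|nS] := eqVneq #|S| 1%N.
  by rewrite cov_coef mxE.
have /eqP -> : al S == 0 by apply: contraNT nS => /h ->.
by apply/esym/eqP; apply: contraNT nS => /homog_cov ->.
Qed.

Lemma covD v w : cov (v + w) = cov v + cov w.
Proof. by rewrite -big_split; apply: eq_bigr => i _; rewrite mxE scalerDl. Qed.

Lemma covZ c v : cov (c *: v) = c *: cov v.
Proof. by rewrite scaler_sumr; apply: eq_bigr => i _; rewrite mxE scalerA. Qed.

Lemma cov_delta i : cov (delta_mx 0 i) = covec R i.
Proof.
rewrite /cov (bigD1 i) //= big1 => [|j ji]; rewrite mxE eqxx /=.
  by rewrite eqxx scale1r addr0.
by rewrite (negPf ji) scale0r.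
Qed.

Lemma contract_ebasis0 v : contract v (ebasis R set0) = 0.
Proof.
apply/ffunP => S; rewrite !ffunE big1 // => i _; rewrite ffunE.
have [e|] := eqVneq (i |: S) set0; last by rewrite mulr0.
by have := setU11 i S; rewrite e inE.
Qed.

Lemma contract_homog1 v al : homog 1 al ->
  contract v al = (\sum_i v 0 i * al [set i]) *: ebasis R set0.
Proof.
move=> h; rewrite [LHS]homog0E; last exact: homog_contract.
congr (_ *: _); rewrite ffunE; apply: eq_big => [i|i _]; first by rewrite inE.
have s0 S : shuffle_sgn R S set0 = 1.
  by rewrite shuffle_sgnE big1 // => k _; rewrite big1 // => j _; rewrite inE andbF.
by rewrite s0 mul1r setU0.
Qed.

Lemma contract_cov v w : contract v (cov w) = pairing v w *: ebasis R set0.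
Proof.
rewrite contract_homog1; last exact: homog_cov.
by congr (_ *: _); apply: eq_bigr => i _; rewrite cov_coef.
Qed.

Lemma contract_cov_wedge v w al :
  contract v (wedge (cov w) al) = pairing v w *: al - wedge (cov w) (contract v al).
Proof.
rewrite contract_wedge contract_cov wedgeZl wedge1l (ginv_odd (@homog_cov w)) //.
by rewrite wedgeNl.
Qed.

Lemma cov_anti v w : wedge (cov v) (cov w) = - wedge (cov w) (cov v).
Proof.
rewrite wedge_oddC ?(ginv_odd (@homog_cov _)) // wedgeNl //.
Qed.

Lemma cov_sq v : wedge (cov v) (cov v) = 0.
Proof.
apply/eqP; have /eqP := cov_anti v v.
by rewrite -addr_eq0 -mulr2n -scaler_nat scaler_eq0 pnatr_eq0.
Qed.

Lemma wedge_covl w al : wedge (cov w) al = \sum_i w 0 i *: wedge (covec R i) al.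
Proof. by rewrite [in LHS]/cov wedge_suml; apply: eq_bigr => i _; rewrite wedgeZl. Qed.

Lemma covA v w al : wedge (cov v) (wedge (cov w) al) = - wedge (cov w) (wedge (cov v) al).
Proof. by rewrite !wedgeA cov_anti wedgeNl. Qed.

Lemma cov_sqA v al : wedge (cov v) (wedge (cov v) al) = 0.
Proof. by rewrite wedgeA cov_sq wedge0l. Qed.

Lemma contract_top v al : contract v al setT = 0.
Proof. by rewrite ffunE big1 // => i; rewrite inE. Qed.

Lemma contractC v w al : contract v (contract w al) = - contract w (contract v al).
Proof.
apply/eqP; rewrite -addr_eq0; apply/eqP.
have := contract2_eq0 (v + w) al.
by rewrite !contractDl !contractDr !contract2_eq0 add0r addr0 addrC.
Qed.

(** Contract [wedge (cov w) (ebasis R setT) = 0] with [v]: the two terms of the Leibniz rule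
    cancel. *)
Lemma wedge_cov_contract_top w v (k : R) :
  wedge (cov w) (contract v (k *: ebasis R setT)) setT = k * pairing v w.
Proof.
have w0 : wedge (cov w) (ebasis R setT) = 0.
  apply/ffunP => S; rewrite !ffunE big1 // => T sTS; rewrite ffunE.
  have [e|] := eqVneq (S :\: T) setT; last by rewrite mulr0.
  suff -> : T = set0.
    have [->|/homog_cov] := eqVneq (cov w set0) 0; first by rewrite mulr0 mul0r.
    by rewrite cards0.
  apply/setP => i; rewrite inE; apply/negP => iT.
  by have := in_setT i; rewrite -e inE iT.
have e : wedge (cov w) (contract v (ebasis R setT)) setT = pairing v w.
  have /ffunP/(_ setT) := contract_cov_wedge v w (ebasis R setT).
  rewrite w0 contract0r !ffunE eqxx => /esym/eqP; rewrite subr_eq0 => /eqP <-.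
  by rewrite /GRing.scale /= mulr1.
by rewrite contractZr wedgeZr ffunE e.
Qed.

(** Lets a coefficient be read off by wedging with the complementary monomial. *)
Lemma wedge_ebasis_top S ga : wedge (ebasis R S) ga setT = shuffle_sgn R S (~: S) * ga (~: S).
Proof.
rewrite ffunE (bigD1 S) ?subsetT //= ffunE eqxx mulr1 setTD big1 ?addr0 // => T.
by case/andP => _ /negPf nT; rewrite ffunE nT mulr0 mul0r.
Qed.

(** For a 3-form this is the value al(x, y, z), the first argument being contracted first;
    [tri_cov3] is the determinant formula. *)
Definition tri al x y z : R := contract z (contract y (contract x al)) set0.

Lemma triDl al x x' y z : tri al (x + x') y z = tri al x y z + tri al x' y z.
Proof. by rewrite /tri contractDl !contractDr ffunE. Qed.
Lemma tri12 al x y z : tri al x y z = - tri al y x z.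
Proof. by rewrite /tri [contract y (contract x al)]contractC contractNr ffunE. Qed.
Lemma tri23 al x y z : tri al x y z = - tri al x z y.
Proof. by rewrite /tri contractC ffunE. Qed.

Lemma contract_homog1_tri al u x z : homog 3 al ->
  tri al u x z = \sum_i z 0 i * contract x (contract u al) [set i].
Proof.
move=> h; rewrite /tri contract_homog1; last by do 2!apply: homog_contract.
by rewrite !ffunE eqxx /GRing.scale /= mulr1.
Qed.

Lemma tri_sum (I : finType) (P : pred I) (F : I -> exterior R n) x y z :
  tri (\sum_(i | P i) F i) x y z = \sum_(i | P i) tri (F i) x y z.
Proof. by rewrite /tri !contract_sumr sum_ffunE. Qed.

Lemma triZ c al x y z : tri (c *: al) x y z = c * tri al x y z.
Proof. by rewrite /tri !contractZr ffunE. Qed.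

Lemma triD al be x y z : tri (al + be) x y z = tri al x y z + tri be x y z.
Proof. by rewrite /tri !contractDr ffunE. Qed.

Lemma tri_cov3 (a b c : 'rV[R]_n) x y z :
  tri (wedge (cov a) (wedge (cov b) (cov c))) x y z =
  pairing x a * (pairing y b * pairing z c - pairing y c * pairing z b)
  - pairing x b * (pairing y a * pairing z c - pairing y c * pairing z a)
  + pairing x c * (pairing y a * pairing z b - pairing y b * pairing z a).
Proof.
rewrite /tri !(contract_cov_wedge, contractDr, contractNr, contractZr, contract_cov,
   wedgeZr, wedge1r, wedgeDr, wedgeNr).
rewrite !contract_ebasis0 !wedge0r !ffunE eqxx /GRing.scale /=; ring.
Qed.

Lemma ebasis_sum al : al = \sum_S al S *: ebasis R S.
Proof.
apply/ffunP => T; rewrite sum_ffunE (bigD1 T) //= !ffunE eqxx big1 => [|S nS].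
  by rewrite addr0 /GRing.scale /= mulr1.
by rewrite !ffunE eq_sym (negPf nS) scaler0.
Qed.

Lemma homog_d_covec br k : homog 2 (d_covec br k : exterior R n).
Proof.
apply: homog_sum => i _; apply: homog_sum => j _; apply: homogZ.
exact: (homog_wedge (@homog_covec i) (@homog_covec j)).
Qed.

Lemma pairing_delta i w : pairing (delta_mx 0 i) w = w 0 i.
Proof.
rewrite /pairing (bigD1 i) //= big1 => [|j ji]; rewrite mxE eqxx /=.
  by rewrite eqxx mul1r addr0.
by rewrite (negPf ji) mul0r.
Qed.

Lemma pairingC v w : pairing v w = pairing w v.
Proof. by apply: eq_bigr => i _; rewrite mulrC. Qed.

Lemma pairingDr x y z : pairing x (y + z) = pairing x y + pairing x z.
Proof. by rewrite -big_split; apply: eq_bigr => i _; rewrite mxE mulrDr. Qed.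

Lemma pairingZr x c y : pairing x (c *: y) = c * pairing x y.
Proof. by rewrite /pairing mulr_sumr; apply: eq_bigr => i _; rewrite mxE mulrCA. Qed.

(** Replaces the recursion along [enum S] by the formula d = sum_k d f^k /\ (f_k _| .). The Leibniz
    rule for d then follows from that for contraction, since each d f^k is even and commutes. *)
Lemma dCE_contract br al :
  dCE br al = \sum_k wedge (d_covec br k) (contract (delta_mx 0 k) al).
Proof.
rewrite {2}(ebasis_sum al) /dCE.
under [RHS]eq_bigr => k _ do rewrite contract_sumr wedge_sumr.
rewrite exchange_big; apply: eq_bigr => S _ /=.
under eq_bigr => k _ do rewrite contractZr wedgeZr.
rewrite -scaler_sumr -wedge_seq_enum; congr (_ *: _).
elim: (enum S) => [|i s IH] /=.
  by rewrite big1 // => k _; rewrite contract_ebasis0 wedge0r.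
under [RHS]eq_bigr => k _ do rewrite -cov_delta contract_cov_wedge wedgeDr wedgeZr wedgeNr.
rewrite big_split /= sumrN IH; congr (_ - _).
  rewrite (bigD1 i) //= big1 => [|k ki]; rewrite pairing_delta !mxE eqxx /=.
    by rewrite eqxx scale1r addr0.
  by rewrite (negPf ki) scale0r.
rewrite wedge_sumr; apply: eq_bigr => k _.
rewrite !wedgeA cov_delta; congr (wedge _ _).
by apply/esym/wedge_evenC/(ginv_even (@homog_d_covec br k)).
Qed.

Lemma homog_dCE br k al : homog k.+1 al -> homog k.+2 (dCE br al).
Proof.
move=> h; rewrite dCE_contract; apply: homog_sum => i _.
by apply: (homog_wedge (@homog_d_covec br i)); apply: homog_contract.
Qed.

Lemma dCE_wedge br al be :
  dCE br (wedge al be) = wedge (dCE br al) be + wedge (ginv al) (dCE br be).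
Proof.
rewrite !dCE_contract wedge_suml wedge_sumr -big_split; apply: eq_bigr => k _ /=.
rewrite contract_wedge wedgeDr !wedgeA; congr (_ + wedge _ _).
exact/wedge_evenC/(ginv_even (@homog_d_covec br k)).
Qed.

End Forms.

(** * Cross products *)

Section CrossProduct.
Variables (R : realFieldType) (V : lmodType R).
Variables (dot : V -> V -> R) (phi psi : V -> V -> V -> R) (X A : V -> V -> V).
Hypothesis dotC : forall u v, dot u v = dot v u.
Hypothesis dotDl : forall u v w, dot (u + v) w = dot u w + dot v w.
Hypothesis dotZl : forall c u v, dot (c *: u) v = c * dot u v.
Hypothesis dot_gt0 : forall u, u != 0 -> 0 < dot u u.
Hypothesis phiDl : forall u v y z, phi (u + v) y z = phi u y z + phi v y z.
Hypothesis phi12 : forall u v w, phi u v w = - phi v u w.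
Hypothesis phi23 : forall u v w, phi u v w = - phi u w v.
Hypothesis dotX : forall u v w, dot (X u v) w = phi u v w.
Hypothesis psiDl : forall u v y z, psi (u + v) y z = psi u y z + psi v y z.
Hypothesis psi23 : forall u v w, psi u v w = - psi u w v.
Hypothesis dotA : forall u v w, dot (A u v) w = psi u v w.
Hypothesis psiX : forall u y x,
  psi u y (X u x) = 2 * (dot u u * dot x y - dot u x * dot u y).
Hypothesis perp2 : forall x y, exists z, [/\ z != 0, dot x z = 0 & dot y z = 0].

Lemma dotDr u v w : dot u (v + w) = dot u v + dot u w.
Proof. by rewrite dotC dotDl !(dotC u). Qed.

Lemma dotZr c u v : dot u (c *: v) = c * dot u v.
Proof. by rewrite dotC dotZl (dotC u). Qed.

Lemma dot0 u : dot 0 u = 0.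
Proof. by rewrite -(scale0r 0) dotZl mul0r. Qed.

Lemma phiaa u v : phi u u v = 0.
Proof. by have := phi12 u u v; lra. Qed.

Lemma phibb u v : phi u v v = 0.
Proof. by have := phi23 u v v; lra. Qed.

Lemma phiaba u v : phi u v u = 0.
Proof. by rewrite phi23 phiaa oppr0. Qed.

Lemma phiC u v w : phi u v w = phi v w u.
Proof. by rewrite phi12 phi23 opprK. Qed.

Lemma dotX12 u v w : dot (X u v) w = - dot (X v u) w.
Proof. by rewrite !dotX phi12. Qed.

Lemma dotXC u v w : dot (X u v) w = dot (X w u) v.
Proof. by rewrite !dotX phiC phiC. Qed.

Lemma normX u v : dot (X u v) (X u v) = dot (X v u) (X v u).
Proof. by rewrite dotX12 dotC dotX12 opprK. Qed.

Lemma psiXA u y w x : psi u y (X w x) = phi w x (A u y).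
Proof. by rewrite -dotA dotC dotX. Qed.

(** [psiX] with y = u gives phi(u, x, A u u) = 0 for all x, so X u (A u u) = 0. Putting x = A u u
    into [psiX] then gives |u|^2 g(A u u, y) = 0, because A u u is orthogonal to u. *)
Lemma psiaa u y : psi u u y = 0.
Proof.
have psibb z : psi u z z = 0 by have := psi23 u z z; lra.
have XA0 x : dot (X u (A u u)) x = 0.
  by have := psiX u u x; rewrite psiXA phi23 -dotX (dotC x u); lra.
have := psiX u y (A u u); rewrite -dotA dotC XA0 !(dotC u (A _ _)) !dotA psibb mul0r subr0.
have [-> _|/dot_gt0 u0 /esym/eqP] := eqVneq u 0.
  by have := psiDl 0 0 0 y; rewrite addr0; lra.
by rewrite !mulf_eq0 pnatr_eq0 (gt_eqF u0) /= => /eqP.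
Qed.

Lemma psiX_polar u w y x : psi u y (X w x) + psi w y (X u x) =
  4 * dot u w * dot x y - 2 * dot u x * dot w y - 2 * dot w x * dot u y.
Proof.
have := psiX (u + w) y x; rewrite psiDl !psiXA !phiDl -!psiXA !psiX.
by rewrite !dotDl !dotDr (dotC w u); lra.
Qed.

(* [psi (X v x) (X v t) (X v x)] vanishes since [psi] is alternating; moving
   the first argument into [psiX_polar] evaluates it. *)
Lemma cross_double v x t : dot v v * dot (X x t) (X x v) =
  dot v t * dot (X x v) (X x v) - dot v x * dot (X v x) (X v t).
Proof.
set w := X v x.
have h1 := psiX_polar v w (X v t) x.
have h2 := psiX v (X w x) t; rewrite psi23 in h2.
have h3 : psi w (X v t) w = 0 by rewrite psi23 psiaa oppr0.
have h4 : dot v w = 0 by rewrite dotC dotX phiaba.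
have h5 : dot v (X v t) = 0 by rewrite dotC dotX phiaba.
have h6 : dot t (X w x) = - dot (X x t) (X x v).
  by rewrite dotC dotX phiC -dotX dotC /w dotX12 dotC.
have h7 : dot v (X w x) = - dot w w.
  by rewrite dotC dotX phiC -dotX dotX12 -/w.
have h8 : dot (X x v) (X x v) = dot w w by rewrite normX.
rewrite h8; rewrite h3 h4 h5 in h1; rewrite h6 h7 in h2; lra.
Qed.

Lemma cross_orth v x t : dot v x = 0 ->
  dot v v * dot (X x t) (X x v) = dot v t * dot (X x v) (X x v).
Proof. by move=> h; rewrite cross_double h mul0r subr0. Qed.

(** If g(v, t) is nonzero, [cross_orth] evaluates g(x * t, x * v) in two ways and the ratios agree.
    Orthogonal v and t are compared through v + t, which is orthogonal to neither. *)
Lemma cross_ratio x v t : dot v x = 0 -> dot t x = 0 ->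
  dot (X x v) (X x v) * dot t t = dot (X x t) (X x t) * dot v v.
Proof.
have X0 : dot (X x 0) (X x 0) = 0.
  by rewrite normX dotX; have := phiDl 0 0 x (X 0 x); rewrite addr0; lra.
suff base a b : dot a x = 0 -> dot b x = 0 -> dot a b != 0 ->
    dot (X x a) (X x a) * dot b b = dot (X x b) (X x b) * dot a a.
  move=> hv ht; have [vt|] := eqVneq (dot v t) 0; last exact: base.
  have hs : dot (v + t) x = 0 by rewrite dotDl hv ht addr0.
  have vs : dot v (v + t) = dot v v by rewrite dotDr vt addr0.
  have ts : dot t (v + t) = dot t t by rewrite dotDr dotC vt add0r.
  have [->|v0] := eqVneq v 0; first by rewrite dot0 mulr0 X0 mul0r.
  have [->|t0] := eqVneq t 0; first by rewrite dot0 mulr0 X0 mul0r.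
  have vv := dot_gt0 v0; have tt := dot_gt0 t0.
  have h1 := base _ _ hv hs; rewrite vs in h1; have {}h1 := h1 (lt0r_neq0 vv).
  have h2 := base _ _ ht hs; rewrite ts in h2; have {}h2 := h2 (lt0r_neq0 tt).
  have ss : dot (v + t) (v + t) != 0.
    by rewrite dotDl vs ts; apply/lt0r_neq0/addr_gt0.
  apply: (mulfI ss); set r := dot (v + t) (v + t) in h1 h2 *.
  transitivity (dot (X x v) (X x v) * r * dot t t); first by ring.
  rewrite h1; transitivity (dot (X x t) (X x t) * r * dot v v); last by ring.
  by rewrite h2; ring.
move=> ha hb ab.
have h1 := cross_orth b ha; have h2 := cross_orth a hb.
apply: (mulfI ab); rewrite (dotC (X x a) (X x b)) (dotC b a) in h2.
by rewrite mulrA -h1 mulrA -h2; ring.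
Qed.

(** The ratio of |x * v|^2 to |x|^2 |v|^2 is the same for all orthogonal pairs: a vector z
    orthogonal to both x and x0 links (x, v), (x, z), (x0, z) and (x0, v0). A general v is reduced
    to its part orthogonal to x, since x * x = 0. *)
Lemma cross_norm : exists2 mu, 0 < mu & forall x v,
  dot (X x v) (X x v) = mu * (dot x x * dot v v - dot x v ^+ 2).
Proof.
have [x0 [x00 _ _]] := perp2 0 0.
have [v0 [v00 xv0 _]] := perp2 x0 x0.
have xx0 := dot_gt0 x00; have vv0 := dot_gt0 v00.
have nz : X x0 v0 != 0.
  (* If x0 * v0 vanished, [psiX] would give 0 = 2 |x0|^2 |v0|^2. *)
  apply/eqP => h; have := psiX x0 v0 v0.
  by rewrite psiXA -dotX h dot0 xv0; have := mulr_gt0 xx0 vv0; lra.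
pose mu := dot (X x0 v0) (X x0 v0) / (dot x0 x0 * dot v0 v0).
have orth x v : dot x v = 0 -> dot (X x v) (X x v) = mu * (dot x x * dot v v).
  move=> xv; have [z [z0 xz x0z]] := perp2 x x0; have zz := dot_gt0 z0.
  have h1 := @cross_ratio x v z; rewrite !(dotC _ x) in h1; have {}h1 := h1 xv xz.
  have h2 := @cross_ratio z x x0 xz x0z.
  have h3 := @cross_ratio x0 z v0; rewrite !(dotC _ x0) in h3; have {}h3 := h3 x0z xv0.
  rewrite (normX z x) (normX z x0) in h2.
  have e3 : dot (X x0 z) (X x0 z) = mu * (dot x0 x0 * dot z z).
    apply: (mulIf (lt0r_neq0 vv0)); rewrite h3 /mu; field.
    by rewrite !lt0r_neq0.
  have e2 : dot (X x z) (X x z) = mu * (dot x x * dot z z).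
    by apply: (mulIf (lt0r_neq0 xx0)); rewrite h2 e3; ring.
  by apply: (mulIf (lt0r_neq0 zz)); rewrite h1 e2; ring.
exists mu; first by rewrite divr_gt0 ?mulr_gt0 // dot_gt0.
move=> x v; have [->|x1] := eqVneq x 0.
  rewrite dot0 mul0r sub0r expr2 dot0 mul0r oppr0 mulr0.
  by rewrite dotX; have := phiDl 0 0 v (X 0 v); rewrite addr0; lra.
have xx := dot_gt0 x1; pose c := dot x v / dot x x.
pose v' := v + (- c) *: x.
have cE : c * dot x x = dot x v by rewrite /c divfK // lt0r_neq0.
have o : dot x v' = 0 by rewrite dotDr dotZr mulNr cE subrr.
have Xr w : dot (X x (v' + c *: x)) w = dot (X x v') w.
  by rewrite dotXC dotDr dotZr [dot (X w x) x]dotX phibb mulr0 addr0 -dotXC.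
have vE : v = v' + c *: x by rewrite /v' scaleNr subrK.
have -> : dot (X x v) (X x v) = dot (X x v') (X x v').
  by rewrite {1}vE Xr dotC {1}vE Xr.
rewrite (orth _ _ o); congr (_ * _).
rewrite {2}/v' dotDr dotZr (dotC v' x) o mulr0 addr0 {1}/v' dotDl dotZl.
by rewrite mulrDr -cE; ring.
Qed.

(* In fact [mu = 1] for a G2-structure, but its value plays no role here. *)
Lemma cross_form : exists mu : R, [/\ 0 < mu,
  forall x v t, dot (X x v) (X x t) = mu * (dot x x * dot v t - dot x v * dot x t) &
  forall u y z, mu * psi u y z = 2 * phi u y z].
Proof.
have [mu mu0 hn] := cross_norm; exists mu => //.
have XDr x v t w : dot (X x (v + t)) w = dot (X x v) w + dot (X x t) w.
  by rewrite !(dotX12 x) !dotX phiDl opprD.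
(* Polarization of [hn] in its second argument. *)
have h x v t : dot (X x v) (X x t) = mu * (dot x x * dot v t - dot x v * dot x t).
  have := hn x (v + t); rewrite XDr !(dotC _ (X x (v + t))) !XDr.
  rewrite !hn !dotDr !dotDl (dotC (X x t) (X x v)) (dotC t v); lra.
split=> // u y z.
have XX v w t : dot (X v (X v w)) t = - mu * (dot v v * dot w t - dot v w * dot v t).
  by rewrite dotX phi23 -dotX h (dotC t w); lra.
(* psi(u, y, u * (u * z)) is computed twice: here by the double cross product, below by [psiX].
   Comparison determines psi in terms of phi. *)
have h1 : psi u y (X u (X u z)) = - mu * (dot u u * psi u y z).
  have d0 : dot u (A u y) = 0 by rewrite dotC dotA psi23 psiaa oppr0.
  by rewrite -dotA dotC XX (dotC z) dotA d0 mulr0 subr0.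
have := psiX u y (X u z); rewrite h1 (dotC u (X u z)) !dotX phiaba mul0r subr0.
have [-> _|/dot_gt0 u0] := eqVneq u 0.
  have p1 : psi 0 y z = 0 by have := psiDl 0 0 y z; rewrite addr0; lra.
  have p2 : phi 0 y z = 0 by have := phiDl 0 0 y z; rewrite addr0; lra.
  by rewrite p1 p2 !mulr0.
rewrite phi23 => e; apply: (mulfI (lt0r_neq0 u0)); lra.
Qed.

End CrossProduct.

(** * Raising and lowering indices with an inner product *)

Section InnerProduct.
Variables (R : realType) (n : nat).
Implicit Types (g : 'M[R]_n) (u v w c : 'rV[R]_n).

Lemma bilinDl g u v w : bilin g (u + v) w = bilin g u w + bilin g v w.
Proof. by rewrite /bilin !mulmxDl mxE. Qed.

Lemma bilinZl g a v w : bilin g (a *: v) w = a * bilin g v w.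
Proof. by rewrite /bilin -!scalemxAl mxE. Qed.

Lemma bilin_sumr g (I : finType) (P : pred I) (F : I -> 'rV[R]_n) v :
  bilin g v (\sum_(i | P i) F i) = \sum_(i | P i) bilin g v (F i).
Proof. by rewrite /bilin linear_sum mulmx_sumr summxE. Qed.

Lemma bilinC g v w : inner_product g -> bilin g v w = bilin g w v.
Proof.
case=> gs _; rewrite /bilin.
have -> : w *m g *m v^T = (v *m g *m w^T)^T by rewrite !trmx_mul trmxK gs mulmxA.
by rewrite [RHS]mxE.
Qed.

Lemma inner_product_unit g : inner_product g -> g \in unitmx.
Proof. by move=> /inner_product_det_gt0 h; rewrite unitmxE unitfE gt_eqF. Qed.

Lemma pairingE v c : pairing v c = (v *m c^T) 0 0.
Proof. by rewrite mxE; apply: eq_bigr => i _; rewrite mxE. Qed.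

Definition sharp g c : 'rV[R]_n := c *m invmx g.

Lemma bilin_sharp g c v : inner_product g -> bilin g (sharp g c) v = pairing v c.
Proof.
move=> hg; rewrite pairingC pairingE /bilin /sharp mulmxKV //.
exact: inner_product_unit.
Qed.

Lemma pairing_flat g v w : inner_product g -> pairing w (v *m g) = bilin g v w.
Proof. by move=> hg; rewrite pairingC pairingE. Qed.

Lemma bilin_inj g v v' : inner_product g -> (forall w, bilin g v w = bilin g v' w) -> v = v'.
Proof.
move=> hg h; apply/eqP; rewrite -subr_eq0; apply/negPn/negP => /hg.2.
by rewrite bilinDl -scaleN1r bilinZl h mulN1r subrr ltxx.
Qed.

(** Two linear conditions on a space of dimension greater than two have a common nonzero
    solution. *)
Lemma perp2_exists g x y : (2 < n)%N ->
  inner_product g -> exists z, [/\ z != 0, bilin g x z = 0 & bilin g y z = 0].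
Proof.
move=> n2 hg; pose M := row_mx (g *m x^T) (g *m y^T).
have k0 : kermx M != 0.
  rewrite -mxrank_eq0 mxrank_ker subn_eq0 -ltnNge.
  exact: leq_ltn_trans (rank_leq_col M) _.
have := nz_row_sub (kermx M); move/sub_kermxP; set z := nz_row _ => zM.
exists z; split; first by rewrite /z nz_row_eq0.
  have := congr1 lsubmx zM; rewrite mul_mx_row row_mxKl => h.
  by rewrite bilinC // /bilin -mulmxA h !mxE.
have := congr1 rsubmx zM; rewrite mul_mx_row row_mxKr => h.
by rewrite bilinC // /bilin -mulmxA h !mxE.
Qed.

End InnerProduct.

(** * The cross product and the dual 4-form of a G2-structure *)

Section G2Algebra.
Variables (R : realType) (phi : exterior R 7) (g : 'M[R]_7) (kap : R).
Hypotheses (h3 : homog 3 phi) (hg : inner_product g) (kap0 : kap != 0).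
Hypothesis metricE : forall v w, bilin g v w *: (kap *: ebasis R setT) =
  6%:R^-1 *: wedge (wedge (contract v phi) (contract w phi)) phi.
Implicit Types u v w x y z : 'rV[R]_7.

Lemma even_contract v : ginv (contract v phi) = contract v phi.
Proof. exact/(@ginv_even _ _ 2)/isT/homog_contract. Qed.

(** With T the left-hand side and S = (u _| phi)^2 /\ (x _| phi), contracting the identity for (u,
    u) with x gives 2T + S, and contracting the one for (u, x) with u gives S - T. The difference is
    3T, and 6/3 is the factor 2. *)
Lemma contract_contract_phi u x :
  wedge (contract x (contract u phi)) (wedge (contract u phi) phi) =
  2 *: contract (bilin g u u *: x - bilin g u x *: u) (kap *: ebasis R setT).
Proof.
set om := kap *: _; set T := wedge _ _.
set S := wedge (wedge (contract u phi) (contract u phi)) (contract x phi).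
have six v w : wedge (wedge (contract v phi) (contract w phi)) phi = 6 *: (bilin g v w *: om).
  by rewrite metricE scalerA divff ?scale1r // pnatr_eq0.
have e1 : T + T + S = 6 *: (bilin g u u *: contract x om).
  rewrite -!contractZr -six contract_wedge wedge_ginv even_contract contract_wedge.
  rewrite even_contract wedgeDl; congr (_ + _ + _); first by rewrite /T wedgeA.
  by rewrite /T wedgeA; congr wedge; apply/esym/wedge_evenC/even_contract.
have e2 : S - T = 6 *: (bilin g u x *: contract u om).
  rewrite -!contractZr -six contract_wedge wedge_ginv !even_contract contract_wedge.
  rewrite contract2_eq0 wedge0l add0r even_contract contractC wedgeNr wedgeNl addrC.
  congr (- _ + _); first by rewrite /T wedgeA; congr wedge; apply/esym/wedge_evenC/even_contract.
  rewrite /S -!wedgeA; congr wedge; exact/wedge_evenC/even_contract.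
apply: (scalerI (a := 3)); first by rewrite pnatr_eq0.
transitivity ((T + T + S) - (S - T)).
  clearbody T S; apply/ffunP => B; rewrite !ffunE /GRing.scale /=; ring.
rewrite e1 e2 contractDl -[- (_ *: u)]scaleNr !contractZl.
move: (contract x om) (contract u om) => a b.
apply/ffunP => B; rewrite !ffunE /GRing.scale /=; ring.
Qed.

Definition cross u x : 'rV[R]_7 := sharp g (\row_i contract x (contract u phi) [set i]).

(** Up to a constant, the Hodge dual of (u _| phi) /\ phi evaluated at (y, z), written as a top
    coefficient. It takes the place of [psi] in [cross_form]. *)
Definition wform u y z : R := kap^-1 *
  wedge (cov (y *m g)) (wedge (cov (z *m g)) (wedge (contract u phi) phi)) setT.

(** The vector representing [wform u y] under [g]: its coordinates arise by putting f^i in place of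
    the covector [cov (z *m g)]. *)
Definition wcross u y : 'rV[R]_7 := \row_i (kap^-1 *
  wedge (cov (y *m g)) (wedge (covec R i) (wedge (contract u phi) phi)) setT).

Lemma bilin_cross u x w : bilin g (cross u x) w = tri phi u x w.
Proof.
rewrite bilin_sharp // contract_homog1_tri //.
by apply: eq_bigr => i _; rewrite mxE.
Qed.

Lemma cov_cross u x : cov (cross u x *m g) = contract x (contract u phi).
Proof.
rewrite /cross /sharp mulmxKV ?inner_product_unit // -homog1E //.
by do 2!apply: homog_contract.
Qed.

Lemma bilin_wcross u y z : bilin g (wcross u y) z = wform u y z.
Proof.
rewrite bilinC // -pairing_flat // pairingC /wform.
rewrite (wedge_covl (z *m g)) wedge_sumr sum_ffunE mulr_sumr; apply: eq_bigr => i _.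
rewrite wedgeZr [wcross _ _ _ _]mxE ext_scaleE; ring.
Qed.

Lemma wform23 u y z : wform u y z = - wform u z y.
Proof. by rewrite /wform covA ffunE mulrN. Qed.

Lemma wformDl u v y z : wform (u + v) y z = wform u y z + wform v y z.
Proof. by rewrite /wform contractDl wedgeDl !wedgeDr ffunE mulrDr. Qed.

Lemma wform_cross u y x : wform u y (cross u x) =
  2 * (bilin g u u * bilin g x y - bilin g u x * bilin g u y).
Proof.
rewrite /wform cov_cross contract_contract_phi -contractZl.
rewrite wedge_cov_contract_top mulKf // pairing_flat // bilinC //.
by rewrite bilinZl bilinDl -scaleNr !bilinZl mulNr.
Qed.

Lemma G2_cross : exists mu : R, [/\ 0 < mu,
  forall x v t, bilin g (cross x v) (cross x t) =
    mu * (bilin g x x * bilin g v t - bilin g x v * bilin g x t) &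
  forall u y z, mu * wform u y z = 2 * tri phi u y z].
Proof.
apply: (@cross_form _ _ (bilin g) (tri phi) wform cross wcross).
- by move=> u v; apply: bilinC.
- by move=> u v w; apply: bilinDl.
- by move=> c u v; apply: bilinZl.
- by move=> u; apply: hg.2.
- by move=> u v y z; apply: triDl.
- by move=> u v w; apply: tri12.
- by move=> u v w; apply: tri23.
- exact: bilin_cross.
- exact: wformDl.
- exact: wform23.
- exact: bilin_wcross.
- exact: wform_cross.
- by move=> x y; apply: perp2_exists.
Qed.

End G2Algebra.

(** * The differential of h3 + h3 + R *)

(** The size is a cardinal [#|S|] that is only provably equal to 3, so the entries are indexed by
    natural numbers to avoid casts between ordinals. *)
Lemma det_mx33_nat (R : comNzRingType) m (F : nat -> nat -> R) (e : m = 3) :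
  \det (\matrix_(i < m, j < m) F i j) =
    F 0%N 0%N * (F 1%N 1%N * F 2%N 2%N - F 1%N 2%N * F 2%N 1%N)
  - F 0%N 1%N * (F 1%N 0%N * F 2%N 2%N - F 1%N 2%N * F 2%N 0%N)
  + F 0%N 2%N * (F 1%N 0%N * F 2%N 1%N - F 1%N 1%N * F 2%N 0%N).
Proof.
subst m; rewrite (expand_det_row _ ord0) !big_ord_recl big_ord0 /cofactor.
rewrite !(expand_det_row _ (ord0 : 'I_2)) !big_ord_recl !big_ord0 /cofactor !det_mx11 !mxE /=.
by rewrite /bump /=; ring.
Qed.

(** * Pairing with the Hodge dual of a 3-form *)

Section Hodge.
Variables (R : realType) (n : nat).
Implicit Types (phi om : exterior R n) (g : 'M[R]_n).

Lemma enum_sorted (s : seq 'I_n) :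
  sorted (fun i j : 'I_n => (i < j)%N) s -> enum [set i in s] = s.
Proof.
have tr : transitive (fun i j : 'I_n => (i < j)%N).
  by move=> y x z; apply: ltn_trans.
move=> ss; apply: (irr_sorted_eq tr) => // [i||i]; first exact: ltnn.
  apply: (sorted_filter tr).
  rewrite -(@sorted_map _ _ (fun i : 'I_n => (i : nat)) ltn) -enumT val_enum_ord.
  exact: iota_ltn_sorted.
by rewrite mem_enum inE.
Qed.

Definition usharp g (i : 'I_n) : 'rV[R]_n := sharp g (delta_mx 0 i).

Lemma usharpE g i j : usharp g i 0 j = invmx g i j.
Proof. by rewrite /usharp /sharp -rowE mxE. Qed.

(** For each monomial f^T of [phi], both sides are the 3 x 3 minor of the inverse of [g] with rows
    i, j, k and columns T: the rows are the coordinates of the vectors [usharp]. *)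
Lemma form_inner_tri g phi (i j k : 'I_n) : (i < j < k)%N -> homog 3 phi ->
  form_inner g (ebasis R [set l in [:: i; j; k]]) phi =
  tri phi (usharp g i) (usharp g j) (usharp g k).
Proof.
move=> /andP[ij jk] h3; rewrite form_inner_ebasisl {2}(ebasis_sum phi) tri_sum.
apply: eq_bigr => T _; rewrite triZ.
have [->|/h3 T3] := eqVneq (phi T) 0; first by rewrite !mul0r.
congr (_ * _); set S := [set l in _].
have eS : enum S = [:: i; j; k] by apply: enum_sorted; rewrite /= ij jk.
have S3 : #|S| = 3 by rewrite cardE eS.
have eT : size (enum T) = 3 by rewrite -cardE.
rewrite /gram_minor (_ : #|S| == #|T|); last by rewrite S3 T3.
pose F a b := invmx g (nth i (enum S) a) (nth i (enum T) b).
transitivity (\det (\matrix_(a < #|S|, b < #|S|) F a b)).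
  congr (\det _); apply/matrixP => a b; rewrite !mxE /F (enum_val_nth i).
  (* The default in [gram_minor] depends on the row; it may be replaced by [i] because the index is
     below the size of [enum T]. *)
  congr (invmx g _ _); apply: set_nth_default.
  by apply: leq_trans (ltn_ord b) _; rewrite eT S3.
rewrite (det_mx33_nat _ S3) /F eS /= -wedge_seq_enum.
case: (enum T) eT => [|a [|b [|c [|]]]] //= _.
rewrite wedge1r -!cov_delta tri_cov3 !(pairingC _ (delta_mx _ _)) !pairing_delta !usharpE.
ring.
Qed.

Lemma hodge_tri g om phi (i j k : 'I_n) : (i < j < k)%N ->
  homog n om -> homog 3 phi ->
  wedge (wedge (wedge (covec R i) (covec R j)) (covec R k)) (hodge g om phi) setT =
  om setT * tri phi (usharp g i) (usharp g j) (usharp g k).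
Proof.
move=> ijk hom h3; rewrite -form_inner_tri //.
have eS : wedge (wedge (covec R i) (covec R j)) (covec R k) =
    ebasis R [set l in [:: i; j; k]].
  rewrite -wedge_seq_enum enum_sorted /= ?wedge1r ?wedgeA //.
  by case/andP: ijk => -> ->.
have h : homog 3 (ebasis R [set l in [:: i; j; k]]).
  rewrite -eS; apply: (@homog_wedge _ _ 2 1); last exact: homog_covec.
  by apply: (@homog_wedge _ _ 1 1); apply: homog_covec.
by rewrite eS (wedge_hodge _ hom h h3) ext_scaleE mulrC.
Qed.

Lemma homog_hodge k g om phi : homog k phi -> homog (n - k) (hodge g om phi).
Proof.
move=> hk T; rewrite ffunE; have [->|h _] := eqVneq (form_inner g (ebasis R (~: T)) phi) 0.
  by rewrite mulr0 mul0r eqxx.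
by rewrite -(form_inner_ebasis_neq0 hk h) -[in X in (X - _)%N](card_ord n) -(cardsC T) addnK.
Qed.

End Hodge.

(** * The differential and the coclosedness equations *)

Section H3H3R.
Variable R : realType.
Local Notation d := (dCE (@h3h3R_br R)).
Implicit Types (al be ga phi : exterior R 7) (i j : 'I_7).
Definition f12 : exterior R 7 := wedge (covec R i1) (covec R i2).
Definition f34 : exterior R 7 := wedge (covec R i3) (covec R i4).

Lemma dE al : d al = wedge f12 (contract (fvec R i5) al) + wedge f34 (contract (fvec R i6) al).
Proof.
rewrite dCE_contract (bigD1 i5) //= (bigD1 i6) //= -!dCE_covec !d_h3h3R /=.
rewrite big1 ?addr0 // => k /andP[/negPf k5 /negPf k6].
by rewrite -dCE_covec d_h3h3R k5 k6 wedge0l.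
Qed.

Lemma homog_f12 : homog 2 f12.
Proof. exact: (homog_wedge (@homog_covec R _ _) (@homog_covec R _ _)). Qed.
Lemma homog_f34 : homog 2 f34.
Proof. exact: (homog_wedge (@homog_covec R _ _) (@homog_covec R _ _)). Qed.

Lemma wedge_f34C al : wedge f34 al = wedge al f34.
Proof. exact/wedge_evenC/(ginv_even homog_f34). Qed.

Lemma contract_covec2 (k i j : 'I_7) : k != i -> k != j ->
  contract (fvec R k) (wedge (covec R i) (covec R j)) = 0.
Proof.
move=> ki kj; rewrite -!cov_delta contract_cov_wedge contract_cov !pairing_delta !mxE.
by rewrite (negPf ki) (negPf kj) !scale0r wedge0r subr0.
Qed.

(** Unimodularity: f_5 _| f^12 = 0 and f_6 _| f^34 = 0, so both terms of d are contractions of a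
    form and have no top component. This yields integration by parts. *)
Lemma d_top al : d al setT = 0.
Proof.
have c12 : contract (fvec R i5) f12 = 0 by apply: contract_covec2.
have c34 : contract (fvec R i6) f34 = 0 by apply: contract_covec2.
rewrite dE ffunE.
have := contract_top (fvec R i5) (wedge f12 al); have := contract_top (fvec R i6) (wedge f34 al).
rewrite (contract_wedge _ f12) (contract_wedge _ f34) c12 c34 !wedge0l !add0r.
by rewrite (ginv_even homog_f12) // (ginv_even homog_f34) // => -> ->; rewrite addr0.
Qed.

Lemma d_by_parts be ga : ginv be = be ->
  wedge (d be) ga setT = - wedge be (d ga) setT.
Proof.
move=> h; apply/eqP; rewrite -addr_eq0; apply/eqP.
by have := d_top (wedge be ga); rewrite dCE_wedge h ffunE.
Qed.

Lemma d_covec2 i j : d (wedge (covec R i) (covec R j)) =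
  wedge (d (covec R i)) (covec R j) - wedge (d (covec R j)) (covec R i).
Proof.
rewrite dCE_wedge (ginv_odd (@homog_covec R _ i)) // wedgeNl; congr (_ - _).
apply/esym/wedge_evenC/(@ginv_even _ _ 2) => //; exact/homog_dCE/homog_covec.
Qed.

Section Coclosed.
Variables (g : 'M[R]_7) (om phi : exterior R 7).
Hypotheses (hom : homog 7 om) (om0 : om setT != 0) (h3 : homog 3 phi).
Local Notation u i := (usharp g i).
Local Notation t := (tri phi).

Let G (i j : 'I_7) : R := wedge (wedge (d (covec R i)) (covec R j)) (hodge g om phi) setT.

(** The 5-form d*phi is tested against all f^i /\ f^j; integration by parts moves d onto the 2-form
    and leaves the difference G j i - G i j. *)
Lemma coclosedP_aux : d (hodge g om phi) = 0 <-> forall i j, G i j = G j i.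
Proof.
have parts i j : wedge (wedge (covec R i) (covec R j)) (d (hodge g om phi)) setT = G j i - G i j.
  have h2 : ginv (wedge (covec R i) (covec R j)) = wedge (covec R i) (covec R j).
    apply: (@ginv_even _ _ 2) => //.
    exact: (homog_wedge (@homog_covec R _ _) (@homog_covec R _ _)).
  apply: oppr_inj; rewrite -(d_by_parts _ h2) d_covec2 wedgeDl wedgeNl opprB.
  by rewrite ext_addE ext_oppE.
split=> [d0 i j|e].
  by apply/esym/eqP; rewrite -subr_eq0 -parts d0 wedge0r ffunE.
apply/ffunP => S; rewrite [RHS]ffunE; apply/eqP; apply: contraT => dS.
have h4 : homog 4 (hodge g om phi) := @homog_hodge _ _ _ g om phi h3.
have h5 : homog 5 (d (hodge g om phi)) by apply: homog_dCE.
(* A nonzero coefficient sits on a set of five indices, whose complement {i, j} is the test pair. *)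
have /eqP/cards2P[i [j [nij eS]]] : #|~: S| = 2.
  by apply/eqP; rewrite -(eqn_add2l #|S|) cardsC card_ord (h5 _ dS).
have := parts i j; rewrite e subrr wedge_ebasis; last by rewrite disjoints1 inE.
rewrite wedgeZl ext_scaleE -eS wedge_ebasis_top setCK => /eqP.
by rewrite !mulf_eq0 (negPf dS) orbF !signr_eq0.
Qed.

(** [hodge_tri] covers increasing triples only. If j repeats an index of d f^i both sides vanish; if
    j precedes 3 and 4, f^34 is moved past f^j and phi is permuted cyclically. *)
Lemma GE (i j : 'I_7) : G i j =
  if i == i5 then om setT * t (u i1) (u i2) (u j) else
  if i == i6 then om setT * t (u i3) (u i4) (u j) else 0.
Proof.
have t0 x y : t x x y = 0 by have := tri12 phi x x y; lra.
have t1 x y : t x y y = 0 by have := tri23 phi x y y; lra.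
have t2 x y : t x y x = 0 by rewrite tri23 t0 oppr0.
rewrite /G d_h3h3R; case: eqP => [_|_].
  have [j2|] := ltnP i2 j; first by rewrite hodge_tri.
  rewrite leq_eqVlt => /predU1P[/val_inj ->|j1].
    by rewrite t1 mulr0 -!wedgeA -!cov_delta cov_sqA wedge0r ffunE.
  have -> : j = i1 by apply/val_inj; case: j j1 => -[].
  by rewrite t2 mulr0 -!wedgeA -!cov_delta covA cov_sqA wedge0r oppr0 ffunE.
case: eqP => [_|_]; last by rewrite !wedge0l ffunE.
have [j4|] := ltnP i4 j; first by rewrite hodge_tri.
rewrite leq_eqVlt => /predU1P[/val_inj ->|j3].
  by rewrite t1 mulr0 -!wedgeA -!cov_delta cov_sqA wedge0r ffunE.
have [/val_inj ->|j2] := eqVneq (j : nat) i3.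
  by rewrite t2 mulr0 -!wedgeA -!cov_delta covA cov_sqA wedge0r oppr0 ffunE.
have {j2}j3 : (j < i3)%N by rewrite ltn_neqAle j2 -ltnS.
rewrite -/f34 wedge_f34C /f34 wedgeA hodge_tri ?j3 //.
by rewrite tri12 tri23 opprK.
Qed.

Lemma coclosedP : d (hodge g om phi) = 0 <->
  [/\ forall j, j != i5 -> j != i6 -> t (u i1) (u i2) (u j) = 0,
      forall j, j != i5 -> j != i6 -> t (u i3) (u i4) (u j) = 0 &
      t (u i1) (u i2) (u i6) = t (u i3) (u i4) (u i5)].
Proof.
rewrite coclosedP_aux; split=> [h|[ha hb hc] i j].
  split=> [j /negPf j5 /negPf j6|j /negPf j5 /negPf j6|].
  - by have := h i5 j; rewrite !GE j5 j6 /= => /eqP; rewrite mulf_eq0 (negPf om0) => /eqP.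
  - by have := h i6 j; rewrite !GE j5 j6 /= => /eqP; rewrite mulf_eq0 (negPf om0) => /eqP.
  - by have := h i5 i6; rewrite !GE /= => /(mulfI om0).
rewrite !GE; case: (eqVneq i i5) => [->|ni5].
  case: (eqVneq j i5) => [-> //|nj5]; case: (eqVneq j i6) => [->|nj6]; first by rewrite hc.
  by rewrite ha // mulr0.
case: (eqVneq j i5) => [->|nj5].
  case: (eqVneq i i6) => [->|ni6]; first by rewrite hc.
  by rewrite ha // mulr0.
case: (eqVneq i i6) => [->|ni6].
  by case: (eqVneq j i6) => [-> //|nj6]; rewrite hb // mulr0.
by case: (eqVneq j i6) => [_|//]; rewrite hb // mulr0.
Qed.

End Coclosed.
End H3H3R.

Lemma big_I7 (V : nmodType) (F : 'I_7 -> V) :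
  \sum_i F i = F i1 + F i2 + F i3 + F i4 + F i5 + F i6 + F i7.
Proof.
rewrite !big_ord_recl big_ord0 addr0 !addrA.
by congr (F _ + F _ + F _ + F _ + F _ + F _ + F _); apply: val_inj.
Qed.

(** * Gram relations of a purely coclosed structure *)

Section PureCoclosed.
Variables (R : realType) (phi : exterior R 7) (g : 'M[R]_7) (om : exterior R 7).
Hypotheses (h3 : homog 3 phi) (hG : G2_metric_vol phi g om).
Local Notation u i := (usharp g i).
Local Notation f := (fvec R).
Local Notation t := (tri phi).
Local Notation dot := (bilin g).
Local Notation cross := (cross phi g).

Lemma G2_inner : inner_product g. Proof. by case: hG. Qed.

Lemma om_topE : om = om setT *: ebasis R setT.
Proof. by case: hG => _ /homog_volume /homog_topE. Qed.

Lemma om_top_neq0 : om setT != 0.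
Proof.
case: hG => /inner_product_det_gt0 d0 [o ->] _; rewrite !ffunE eqxx.
rewrite /GRing.scale /= mulr1 mulf_neq0 ?signr_eq0 //.
by rewrite gt_eqF // sqrtr_gt0.
Qed.

Lemma metric_eq v w : dot v w *: (om setT *: ebasis R setT) =
  6%:R^-1 *: wedge (wedge (contract v phi) (contract w phi)) phi.
Proof. by rewrite -om_topE; case: hG. Qed.

Lemma bilin_usharp i v : dot (u i) v = v 0 i.
Proof. by rewrite bilin_sharp; [rewrite pairingC pairing_delta|exact: G2_inner]. Qed.

Lemma cov_usharp i : cov (u i *m g) = covec R i.
Proof. by rewrite /usharp /sharp mulmxKV ?cov_delta //; apply/inner_product_unit/G2_inner. Qed.

(** The form d phi /\ phi is the sum of f^12 /\ (f_5 _| phi) /\ phi and f^34 /\ (f_6 _| phi) /\ phi,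
    that is, of two values of [wform], and [wform] is proportional to phi by [G2_cross]. *)
Lemma pureP : wedge (dCE (@h3h3R_br R) phi) phi = 0 <->
  t (f i5) (u i1) (u i2) + t (f i6) (u i3) (u i4) = 0.
Proof.
have [mu [mu0 _ hw]] := G2_cross h3 G2_inner om_top_neq0 metric_eq.
have top : wedge (dCE (@h3h3R_br R) phi) phi setT = om setT *
    (wform phi g (om setT) (f i5) (u i1) (u i2) + wform phi g (om setT) (f i6) (u i3) (u i4)).
  rewrite /wform !cov_usharp -mulrDr mulrA divff ?om_top_neq0 // mul1r.
  by rewrite dE wedgeDl ext_addE !wedgeA.
have h7 : homog 7 (wedge (dCE (@h3h3R_br R) phi) phi).
  by apply: (@homog_wedge _ _ 4 3) => //; apply: homog_dCE.
have eqv : wedge (dCE (@h3h3R_br R) phi) phi = 0 <->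
    wedge (dCE (@h3h3R_br R) phi) phi setT = 0.
  by split=> [->|e]; [rewrite ffunE|rewrite (homog_topE h7) e scale0r].
rewrite eqv top; have e : mu * (wform phi g (om setT) (f i5) (u i1) (u i2) +
   wform phi g (om setT) (f i6) (u i3) (u i4)) = 2 * (t (f i5) (u i1) (u i2) + t (f i6) (u i3) (u i4)).
  by rewrite !mulrDr !hw.
split=> [/eqP|h].
  rewrite mulf_eq0 (negPf om_top_neq0) => /eqP h.
  by move: e; rewrite h mulr0 => /esym/eqP; rewrite mulf_eq0 pnatr_eq0 => /eqP.
by move: e; rewrite h mulr0 => /eqP; rewrite mulf_eq0 gt_eqF // => /eqP ->; rewrite mulr0.
Qed.

Lemma row_expand (v : 'rV[R]_7) : v = \sum_i v 0 i *: f i.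
Proof. exact: row_sum_delta. Qed.

Lemma usharp_expand v : v = \sum_i dot v (f i) *: u i.
Proof.
apply: (bilin_inj G2_inner) => w.
rewrite {1}(row_expand w) bilin_sumr (bilinC _ w G2_inner) bilin_sumr.
apply: eq_bigr => i _; rewrite !(bilinC _ (_ *: _) G2_inner) !bilinZl.
by rewrite bilin_usharp (bilinC _ v G2_inner) mulrC.
Qed.

Lemma row_center (v : 'rV[R]_7) : v 0 i1 = 0 -> v 0 i2 = 0 -> v 0 i3 = 0 -> v 0 i4 = 0 ->
  v = v 0 i5 *: f i5 + v 0 i6 *: f i6 + v 0 i7 *: f i7.
Proof.
move=> v1 v2 v3 v4; rewrite {1}(row_expand v) big_I7 v1 v2 v3 v4.
by rewrite !scale0r !add0r.
Qed.

(* With [X = u1 * u2] and [Y = u3 * u4] (cross products), [z = g(X, Y)] and the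
   [wi] are the coordinates of [X * u3] in the [ui]: only those with [i <= 4]
   occur, since [X * u3] is orthogonal to [f5], [f6] and [f7]. *)
Lemma gram_relations :
  dCE (@h3h3R_br R) (hodge g om phi) = 0 -> wedge (dCE (@h3h3R_br R) phi) phi = 0 ->
  dot (f i5) (f i7) = 0 -> dot (f i6) (f i7) = 0 ->
  dot (f i5) (f i6) ^+ 2 < dot (f i5) (f i5) * dot (f i6) (f i6) ->
  let h i j := dot (u i) (u j) in
  exists mu del z w1 w2 w3 w4 : R,
  [/\ 0 < mu /\ 0 < del,
      [/\ del * dot (f i6) (f i6) = mu * (h i1 i1 * h i2 i2 - h i1 i2 ^+ 2),
          del * dot (f i5) (f i5) = mu * (h i3 i3 * h i4 i4 - h i3 i4 ^+ 2) &
          z = - (del * dot (f i5) (f i6))],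
      [/\ w1 * h i1 i1 + w2 * h i2 i1 + w3 * h i3 i1 + w4 * h i4 i1 =
             - mu * (h i1 i1 * h i2 i3 - h i1 i2 * h i1 i3),
          w1 * h i1 i2 + w2 * h i2 i2 + w3 * h i3 i2 + w4 * h i4 i2 =
             mu * (h i2 i2 * h i1 i3 - h i1 i2 * h i2 i3),
          w1 * h i1 i3 + w2 * h i2 i3 + w3 * h i3 i3 + w4 * h i4 i3 = 0 &
          w1 * h i1 i4 + w2 * h i2 i4 + w3 * h i3 i4 + w4 * h i4 i4 = z] &
      w2 * (mu * (h i2 i2 * h i1 i3 - h i1 i2 * h i2 i3))
      - w1 * (mu * (h i1 i1 * h i2 i3 - h i1 i2 * h i1 i3)) + w4 * z =
        mu ^+ 2 * (h i1 i1 * h i2 i2 - h i1 i2 ^+ 2) * h i3 i3].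
Proof.
have hom : homog 7 om by case: hG => _ /homog_volume.
move=> /(coclosedP g hom om_top_neq0 h3)[ca cb cc] /pureP pure g57 g67 gram h.
have [mu [mu0 hX _]] := G2_cross h3 G2_inner om_top_neq0 metric_eq.
have dC v w : dot v w = dot w v by apply/bilinC/G2_inner.
have dX v w x : dot (cross v w) x = t v w x by apply/bilin_cross/G2_inner.
have tC x y z : t x y z = t y z x by rewrite tri12 tri23 opprK.
have t0 x y : t x x y = 0 by have := tri12 phi x x y; lra.
have t2 x y : t x y x = 0 by rewrite tri23 t0 oppr0.
set E := dot (f i5) (f i5); set F := dot (f i5) (f i6) in gram *; set G := dot (f i6) (f i6).
rewrite -/E -/G in gram.
pose X := cross (u i1) (u i2); pose Y := cross (u i3) (u i4).
pose p := t (u i1) (u i2) (u i5); pose q := t (u i1) (u i2) (u i6).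
pose r := t (u i3) (u i4) (u i6).
have XE : X = p *: f i5 + q *: f i6.
  apply/rowP => j; rewrite -bilin_usharp dC dX !mxE !eqxx /=.
  have [->|j5] := eqVneq j i5; first by rewrite mulr1 mulr0 addr0.
  have [->|j6] := eqVneq j i6; first by rewrite mulr1 mulr0 add0r.
  by rewrite ca // !mulr0 addr0.
have YE : Y = q *: f i5 + r *: f i6.
  apply/rowP => j; rewrite -bilin_usharp dC dX !mxE !eqxx /=.
  have [->|j5] := eqVneq j i5; first by rewrite mulr1 mulr0 addr0 /q cc.
  have [->|j6] := eqVneq j i6; first by rewrite mulr1 mulr0 add0r.
  by rewrite cb // !mulr0 addr0.
have dotX v : dot X v = p * dot (f i5) v + q * dot (f i6) v by rewrite XE bilinDl !bilinZl.
have dotY v : dot Y v = q * dot (f i5) v + r * dot (f i6) v by rewrite YE bilinDl !bilinZl.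
have pureE : p * E + 2 * q * F + r * G = 0.
  move: pure; rewrite tC -dX -/X tC -dX -/Y dotX dotY.
  by rewrite (dC (f i6) (f i5)) -/E -/F -/G; lra.
(* Minus the determinant of the coefficients of X, Y in f_5, f_6. By pureness the Gram matrix of X,
   Y is [del] times the adjugate of that of f_5, f_6, as the next three facts say entry by entry. *)
pose del := q ^+ 2 - p * r.
have XX : dot X X = del * G.
  rewrite dotX !(dC _ X) !dotX (dC (f i6) (f i5)) -/E -/F -/G /del.
  have -> : p * (p * E + q * F) + q * (p * F + q * G) =
      p * (p * E + 2 * q * F + r * G) + (q ^+ 2 - p * r) * G by ring.
  by rewrite pureE mulr0 add0r.
have YY : dot Y Y = del * E.
  rewrite dotY !(dC _ Y) !dotY (dC (f i6) (f i5)) -/E -/F -/G /del.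
  have -> : q * (q * E + r * F) + r * (q * F + r * G) =
      r * (p * E + 2 * q * F + r * G) + (q ^+ 2 - p * r) * E by ring.
  by rewrite pureE mulr0 add0r.
have XY : dot X Y = - (del * F).
  rewrite dotX !(dC _ Y) !dotY (dC (f i6) (f i5)) -/E -/F -/G /del.
  have -> : p * (q * E + r * F) + q * (q * F + r * G) =
      q * (p * E + 2 * q * F + r * G) - (q ^+ 2 - p * r) * F by ring.
  by rewrite pureE mulr0 sub0r.
have XXg : dot X X = mu * (h i1 i1 * h i2 i2 - h i1 i2 ^+ 2) by rewrite hX expr2.
have YYg : dot Y Y = mu * (h i3 i3 * h i4 i4 - h i3 i4 ^+ 2) by rewrite hX expr2.
have pos v : v != 0 -> 0 < dot v v by apply: G2_inner.2.
have f0 i : f i != 0.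
  by apply/eqP => /rowP/(_ i); rewrite !mxE !eqxx /= => /eqP; rewrite oner_eq0.
have E0 : 0 < E by apply/pos/f0.
have G0 : 0 < G by apply/pos/f0.
have del0 : 0 < del.
  (* If X = 0, then pairing X with u_1 * f_2 would give 0 = mu |u_1|^2, since g(u_2, f_2) = 1 and
     g(u_1, f_2) = 0. *)
  have X0 : X != 0.
    apply/eqP => X0.
    have := hX (u i1) (u i2) (f i2);
      rewrite -/X X0 (dC 0) -(scale0r 0) (dC _ (0 *: 0)) bilinZl mul0r.
    have f22 : f i2 0 i2 = 1 by rewrite mxE.
    have f21 : f i2 0 i1 = 0 by rewrite mxE.
    rewrite !(bilin_usharp _ (f i2)) f22 f21 mulr1 mulr0 subr0 => /esym/eqP.
    rewrite mulf_eq0 gt_eqF //= => /eqP u0.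
    have := pos (u i1); rewrite u0 ltxx => h1.
    suff : u i1 != 0 by move/h1.
    apply/eqP => e; have := bilin_usharp i1 (f i1); rewrite e -(scale0r 0) bilinZl mul0r !mxE /=.
    by move/esym/eqP; rewrite oner_eq0.
  by have := pos _ X0; rewrite XX pmulr_lgt0.
(* As [del] is nonzero, X and Y span the same plane as f_5 and f_6. *)
have col v : dot X v = 0 -> dot Y v = 0 -> dot (f i5) v = 0 /\ dot (f i6) v = 0.
  rewrite dotX dotY => e1 e2; have dn := lt0r_neq0 del0.
  split; apply: (mulfI dn); rewrite mulr0 /del.
    have -> : (q ^+ 2 - p * r) * dot (f i5) v =
        q * (q * dot (f i5) v + r * dot (f i6) v) - r * (p * dot (f i5) v + q * dot (f i6) v) by ring.
    by rewrite e1 e2 !mulr0 subrr.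
  have -> : (q ^+ 2 - p * r) * dot (f i6) v =
      q * (p * dot (f i5) v + q * dot (f i6) v) - p * (q * dot (f i5) v + r * dot (f i6) v) by ring.
  by rewrite e1 e2 !mulr0 subrr.
have uX j : j != i5 -> j != i6 -> dot (u j) X = 0 by move=> *; rewrite dC dX ca.
have uY j : j != i5 -> j != i6 -> dot (u j) Y = 0 by move=> *; rewrite dC dX cb.
have tX1 v : t (u i1) X v = - (mu * (h i1 i1 * dot (u i2) v - h i1 i2 * dot (u i1) v)).
  by rewrite tri23 -dX dC hX.
have tX2 v : t (u i2) X v = mu * (h i2 i2 * dot (u i1) v - h i1 i2 * dot (u i2) v).
  by rewrite tri23 -dX dC dX tri12 opprK -dX hX (dC (u i2) (u i1)).
have tY3 v : t (u i3) Y v = - (mu * (h i3 i3 * dot (u i4) v - h i3 i4 * dot (u i3) v)).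
  by rewrite tri23 -dX dC hX.
have tY4 v : t (u i4) Y v = mu * (h i4 i4 * dot (u i3) v - h i3 i4 * dot (u i4) v).
  by rewrite tri23 -dX dC dX tri12 opprK -dX hX (dC (u i4) (u i3)).
pose Z := cross X Y.
(* The vectors u_1 * X, u_2 * X and u_3 * Y, u_4 * Y are combinations of u_1, ..., u_4, which are
   orthogonal to X and Y. *)
have Z1 : t X Y (u i1) = 0 by rewrite -tC tX1 !uY // !mulr0 subrr mulr0 oppr0.
have Z2 : t X Y (u i2) = 0 by rewrite -tC tX2 !uY // !mulr0 subrr mulr0.
have Z3 : t X Y (u i3) = 0 by rewrite tri12 -tC tY3 !uX // !mulr0 subrr mulr0 !oppr0.
have Z4 : t X Y (u i4) = 0 by rewrite tri12 -tC tY4 !uX // !mulr0 subrr mulr0 oppr0.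
have Zc j : Z 0 j = t X Y (u j) by rewrite -bilin_usharp dC dX.
have ZE : Z = Z 0 i5 *: f i5 + Z 0 i6 *: f i6 + Z 0 i7 *: f i7.
  by apply: row_center; rewrite Zc.
have [Zf5 Zf6] : dot (f i5) Z = 0 /\ dot (f i6) Z = 0.
  by apply: col; rewrite dC dX // tri12 t2 oppr0 // t0.
(* Z lies in the span of f_5, f_6, f_7 and is orthogonal to f_5 and f_6. Both are orthogonal to f_7
   and their Gram determinant is nonzero, so only the f_7 component is left. *)
have Z7 v : dot Z v = Z 0 i7 * dot (f i7) v.
  have h1 : Z 0 i5 * E + Z 0 i6 * F = 0.
    by rewrite -[RHS]Zf5 {3}ZE (dC (f i5)) !bilinDl !bilinZl (dC (f i7)) g57 (dC (f i6)) -/E -/F;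
      ring.
  have h2 : Z 0 i5 * F + Z 0 i6 * G = 0.
    by rewrite -[RHS]Zf6 {3}ZE (dC (f i6)) !bilinDl !bilinZl (dC (f i7)) g67 -/F -/G; ring.
  have D0 : E * G - F ^+ 2 != 0 by rewrite gt_eqF // subr_gt0.
  have z5 : Z 0 i5 = 0.
    apply: (mulIf D0); rewrite mul0r.
    have -> : Z 0 i5 * (E * G - F ^+ 2) =
        G * (Z 0 i5 * E + Z 0 i6 * F) - F * (Z 0 i5 * F + Z 0 i6 * G) by ring.
    by rewrite h1 h2 !mulr0 subrr.
  have z6 : Z 0 i6 = 0.
    apply: (mulIf D0); rewrite mul0r.
    have -> : Z 0 i6 * (E * G - F ^+ 2) =
        E * (Z 0 i5 * F + Z 0 i6 * G) - F * (Z 0 i5 * E + Z 0 i6 * F) by ring.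
    by rewrite h1 h2 !mulr0 subrr.
  by rewrite {1}ZE z5 z6 !scale0r !add0r bilinZl.
(* Otherwise |X * Y|^2 = mu del^2 (EG - F^2) would vanish. *)
have Zn0 : Z 0 i7 != 0.
  apply/eqP => z0; have := hX X Y Y; rewrite -/Z Z7 z0 mul0r => /esym/eqP.
  rewrite mulf_eq0 gt_eqF //= XX YY XY => /eqP h1.
  have : del ^+ 2 * (E * G - F ^+ 2) = 0 by rewrite -[RHS]h1; ring.
  by apply/eqP; rewrite mulf_neq0 ?expf_neq0 ?lt0r_neq0 // subr_gt0.
pose w := cross X (u i3).
have wX : dot X w = 0 by rewrite dC dX t2.
have wY : dot Y w = 0 by rewrite dC dX tri23 Z3 oppr0.
have [w5 w6] := col _ wX wY.
(* g(X * u_3, X * Y) vanishes because u_3 is orthogonal to X and Y, and X * Y is a nonzero multiple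
   of f_7. *)
have w7 : dot (f i7) w = 0.
  apply: (mulfI Zn0); rewrite -Z7 mulr0 dC /w /Z hX.
  by rewrite uY // (dC X (u i3)) uX // mulr0 mul0r subrr mulr0.
have wE v : dot w v = dot w (f i1) * dot (u i1) v + dot w (f i2) * dot (u i2) v
    + dot w (f i3) * dot (u i3) v + dot w (f i4) * dot (u i4) v.
  rewrite {1}(usharp_expand w) big_I7 !bilinDl !bilinZl.
  by rewrite !(dC w (f i5)) !(dC w (f i6)) !(dC w (f i7)) w5 w6 w7 !mul0r !addr0.
have wu1 : dot w (u i1) = - mu * (h i1 i1 * h i2 i3 - h i1 i2 * h i1 i3).
  by rewrite dX -tC tX1 mulNr.
have wu2 : dot w (u i2) = mu * (h i2 i2 * h i1 i3 - h i1 i2 * h i2 i3).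
  by rewrite dX -tC tX2.
have wu3 : dot w (u i3) = 0 by rewrite dX tri23 -tri12 t2.
have wu4 : dot w (u i4) = dot X Y by rewrite dX tC -dX dC.
have ww : dot w w = mu * (dot X X * h i3 i3).
  by rewrite /w hX (dC X (u i3)) uX // mul0r subr0.
exists mu, del, (dot X Y), (dot w (f i1)), (dot w (f i2)), (dot w (f i3)), (dot w (f i4)).
split; [by []|by rewrite -XX -YY|by split; rewrite /h -wE|].
move: ww; rewrite wE !(dC _ w) wu1 wu2 wu3 wu4 XXg => ww.
have -> : forall a b, mu ^+ 2 * a * b = mu * (mu * a * b) by move=> a b; ring.
by rewrite -ww; ring.
Qed.

End PureCoclosed.

(** * Necessity *)

Section Necessity.
Variable R : realType.
Local Notation f := (fvec R).
Implicit Types (phi om : exterior R 7) (g : 'M[R]_7).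

(** [purely_coclosed] and [induces] each choose their own metric and volume form; uniqueness
    identifies the choices. *)
Lemma pcc_metric phi g : purely_coclosed (@h3h3R_br R) phi -> induces phi g ->
  exists om, [/\ G2_metric_vol phi g om, dCE (@h3h3R_br R) (hodge g om phi) = 0 &
    wedge (dCE (@h3h3R_br R) phi) phi = 0].
Proof.
move=> [g' [om' [hg' hd hp]]] [om hg]; exists om.
by have [eg eo] := G2_metric_vol_unique hg hg'; split=> //; rewrite eg eo.
Qed.

Lemma orthogonal_not_pcc g : inner_product g -> orthogonal_decomposition g ->
  ~ exists phi, [/\ G2_structure phi, purely_coclosed (@h3h3R_br R) phi & induces phi g].
Proof.
move=> hg [o12 o13 o23] [phi [[h3 _] hp hi]].
have [om [hG hd hpure]] := pcc_metric hp hi.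
have in1 i : i \in [:: i1; i2; i5] -> f i \in ideal1 R.
  by move=> h; apply: memv_span; apply: (map_f (fvec R) h).
have in2 i : i \in [:: i3; i4; i6] -> f i \in ideal2 R.
  by move=> h; apply: memv_span; apply: (map_f (fvec R) h).
have in3 : f i7 \in ideal3 R by apply: memv_span; rewrite inE.
have dC v w : bilin g v w = bilin g w v by apply: bilinC.
have g12 i j : i \in [:: i1; i2; i5] -> j \in [:: i3; i4; i6] -> bilin g (f i) (f j) = 0.
  by move=> hi' hj; apply: o12; [apply: in1|apply: in2].
have g13 i : i \in [:: i1; i2; i5] -> bilin g (f i) (f i7) = 0.
  by move=> hi'; apply: o13 => //; apply: in1.
have g23 i : i \in [:: i3; i4; i6] -> bilin g (f i) (f i7) = 0.
  by move=> hi'; apply: o23 => //; apply: in2.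
have us := bilin_usharp hG.
have f0 i : f i != 0.
  by apply/eqP => /rowP/(_ i); rewrite !mxE !eqxx /= => /eqP; rewrite oner_eq0.
(* The component [a] of [v] in the first ideal satisfies g(a, a) = g(v, a), so it vanishes if g(v,
   a) does. For v = u_3 or u_4 this holds, because [a] has no coordinate 3 or 4. *)
have part (v : 'rV[R]_7) : bilin g v (v 0 i1 *: f i1 + v 0 i2 *: f i2 + v 0 i5 *: f i5) = 0 ->
   v 0 i1 = 0 /\ v 0 i2 = 0.
  set a := _ + _ => va.
  have aa : bilin g a a = 0.
    rewrite -va {1}(row_expand v) big_I7 !bilinDl !bilinZl.
    have z j : j \in [:: i3; i4; i6; i7] -> bilin g (f j) a = 0.
      move=> hj; rewrite dC /a !bilinDl !bilinZl.
      have g1 i : i \in [:: i1; i2; i5] -> bilin g (f i) (f j) = 0.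
        move=> hi'; have [->|nj] := eqVneq j i7; first exact: g13.
        by apply: g12 => //; move: hj; rewrite !inE (negPf nj) orbF.
      by rewrite !g1 // !mulr0 !addr0.
    by rewrite !(z i3, z i4, z i6, z i7) // !mulr0 !addr0.
  have a0 : a = 0 by apply/eqP/negPn/negP => /hg.2; rewrite aa ltxx.
  by split; [have /rowP/(_ i1) := a0|have /rowP/(_ i2) := a0];
    rewrite !mxE !eqxx /= ?mulr1 ?mulr0 ?addr0 ?add0r.
have hu j : j \in [:: i3; i4] -> usharp g j 0 i1 = 0 /\ usharp g j 0 i2 = 0.
  move=> hj; apply: part.
  rewrite us; move: hj; rewrite !inE => /orP[] /eqP ->; rewrite !mxE /=;
  by rewrite !mulr0 !addr0.
have [h31 h32] := hu i3 isT; have [h41 h42] := hu i4 isT.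
have E0 : 0 < bilin g (f i5) (f i5) by apply: hg.2.
have G0 : 0 < bilin g (f i6) (f i6) by apply: hg.2.
have F0 : bilin g (f i5) (f i6) = 0 by apply: g12.
have [|mu [del [z [w1 [w2 [w3 [w4 [[mu0 del0] [d1 _ zE] _ fin]]]]]]]] :=
  gram_relations h3 hG hd hpure (g13 i5 isT) (g23 i6 isT).
  by rewrite F0 expr0n /= mulr_gt0.
have h33 : 0 < bilin g (usharp g i3) (usharp g i3).
  apply: hg.2; apply/eqP => e; have := us i3 (f i3).
  by rewrite e -(scale0r 0) bilinZl mul0r !mxE /= => /esym/eqP; rewrite oner_eq0.
(* Now g(u_1, u_3) = g(u_2, u_3) = 0 and z = 0, so |X * u_3|^2 = 0. This forces the Gram determinant
   of u_1, u_2 to vanish, against [d1]. *)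
move: fin d1; rewrite zE F0 mulr0 oppr0 !(us i1 (usharp g i3)) !(us i2 (usharp g i3)) h31 h32.
rewrite !(mulr0, subrr, addr0) => /esym/eqP.
rewrite !mulf_eq0 (gt_eqF h33) orbF (gt_eqF mu0) /= => /eqP ->.
by rewrite mulr0 => /eqP; rewrite mulf_eq0 !gt_eqF.
Qed.

Lemma bilin_sprod (i j : 'I_7) v w :
  bilin (sprod R i j) v w = 2^-1 * (v 0 i * w 0 j + v 0 j * w 0 i).
Proof.
have bd p q : (v *m delta_mx p q *m w^T) 0 0 = v 0 p * w 0 q.
  rewrite -mulmxA mxE (bigD1 p) //= big1 => [|k kp].
    rewrite mxE (bigD1 q) //= big1 => [|k kq]; rewrite !mxE eqxx.
      by rewrite eqxx mul1r !addr0.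
    by rewrite (negPf kq) mul0r.
  by rewrite mxE big1 ?mulr0 // => l _; rewrite !mxE (negPf kp) mul0r.
by rewrite /bilin /sprod -scalemxAr mulmxDr -scalemxAl mulmxDl !mxE -!bd !mxE.
Qed.

Lemma bilin_metric a b E F G (v w : 'rV[R]_7) : bilin (metric a b E F G) v w =
  v 0 i1 * w 0 i1 + v 0 i2 * w 0 i2 + v 0 i3 * w 0 i3 + v 0 i4 * w 0 i4
  + a * (v 0 i1 * w 0 i3 + v 0 i3 * w 0 i1) + b * (v 0 i2 * w 0 i4 + v 0 i4 * w 0 i2)
  + E * (v 0 i5 * w 0 i5) + F * (v 0 i5 * w 0 i6 + v 0 i6 * w 0 i5) + G * (v 0 i6 * w 0 i6)
  + v 0 i7 * w 0 i7.
Proof.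
have bD (g h : 'M[R]_7) : bilin (g + h) v w = bilin g v w + bilin h v w.
  by rewrite /bilin mulmxDr mulmxDl mxE.
have bZ k (g : 'M[R]_7) : bilin (k *: g) v w = k * bilin g v w.
  by rewrite /bilin -scalemxAr -scalemxAl mxE.
rewrite /metric !bD (bZ (2%:R * a)) (bZ (2%:R * b)) (bZ E) (bZ (2%:R * F)) (bZ G).
by rewrite !bilin_sprod; field.
Qed.

Lemma pcc_metric_necessary (a b E F G : R) phi :
  0 <= a -> a <= b -> b < 1 -> 0 < E * G - F ^+ 2 ->
  [/\ G2_structure phi, purely_coclosed (@h3h3R_br R) phi & induces phi (metric a b E F G)] ->
  exists eps : R, (eps = 1 \/ eps = -1) /\
    let c := a * b + eps * Num.sqrt ((1 - a ^+ 2) * (1 - b ^+ 2)) in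
    [/\ c ^+ 2 < 1, G = E & F = - E * c].
Proof.
move=> a0 ab b1 EGF [[h3 _] hp hi].
have [om [hG hd hpure]] := pcc_metric hp hi.
have hg := G2_inner hG; set g := metric _ _ _ _ _ in hG hd hg.
have us := bilin_usharp hG.
have a2 : 0 < 1 - a ^+ 2 by nra.
have b2 : 0 < 1 - b ^+ 2 by nra.
have an := lt0r_neq0 a2; have bn := lt0r_neq0 b2.
have u1E : usharp g i1 = (1 - a ^+ 2)^-1 *: (f i1 - a *: f i3).
  apply: (bilin_inj hg) => w; rewrite us bilin_metric !mxE /=; field.
  by rewrite an.
have u3E : usharp g i3 = (1 - a ^+ 2)^-1 *: (f i3 - a *: f i1).
  apply: (bilin_inj hg) => w; rewrite us bilin_metric !mxE /=; field.
  by rewrite an.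
have u2E : usharp g i2 = (1 - b ^+ 2)^-1 *: (f i2 - b *: f i4).
  apply: (bilin_inj hg) => w; rewrite us bilin_metric !mxE /=; field.
  by rewrite bn.
have u4E : usharp g i4 = (1 - b ^+ 2)^-1 *: (f i4 - b *: f i2).
  apply: (bilin_inj hg) => w; rewrite us bilin_metric !mxE /=; field.
  by rewrite bn.
have g57 : bilin g (f i5) (f i7) = 0 by rewrite bilin_metric !mxE /=; ring.
have g67 : bilin g (f i6) (f i7) = 0 by rewrite bilin_metric !mxE /=; ring.
have g55 : bilin g (f i5) (f i5) = E by rewrite bilin_metric !mxE /=; ring.
have g56 : bilin g (f i5) (f i6) = F by rewrite bilin_metric !mxE /=; ring.
have g66 : bilin g (f i6) (f i6) = G by rewrite bilin_metric !mxE /=; ring.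
have [|mu [del [z [w1 [w2 [w3 [w4 [[mu0 del0] [d1 d2 zE] [e1 e2 e3 e4] fin]]]]]]]] :=
  gram_relations h3 hG hd hpure g57 g67.
  by rewrite g55 g56 g66 -subr_gt0.
rewrite g66 !us in d1; rewrite g55 !us in d2; rewrite g56 in zE.
rewrite !us in e1 e2 e3 e4 fin.
rewrite u1E u2E u3E u4E !mxE /= in d1 d2 e1 e2 e3 e4 fin.
set A := (1 - a ^+ 2)^-1 in d1 d2 e1 e2 e3 e4 fin.
set B := (1 - b ^+ 2)^-1 in d1 d2 e1 e2 e3 e4 fin.
have A0 : 0 < A by rewrite invr_gt0.
have B0 : 0 < B by rewrite invr_gt0.
have Aa : A * (1 - a ^+ 2) = 1 by rewrite mulVf.
have dE : del * E = mu * A * B by rewrite d2; ring.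
have dG : del * G = mu * A * B by rewrite d1; ring.
have EG : G = E by apply: (mulfI (lt0r_neq0 del0)); rewrite dG dE.
have E0 : 0 < E by rewrite -(pmulr_rgt0 _ del0) dE !mulr_gt0.
have En := lt0r_neq0 E0.
(* The cosine of the angle between X and Y: their common squared length is mu A B, and z = g(X, Y)
   is [c] times it. *)
pose c := - F / E.
have FE : F = - E * c by rewrite /c; field.
have zc : z = c * (mu * A * B) by rewrite zE -dE FE; ring.
have nz (x y : R) : 0 < x -> x * y = 0 -> y = 0.
  by move=> x0 /eqP; rewrite mulf_eq0 gt_eqF // => /eqP.
(* [k1] and [k2] pair X * u_3 with u_2 and u_4, and [k3] is its squared norm. Eliminating [w2]
   leaves two formulas for [w4], whose comparison is [k6]. *)
have k1 : w2 - b * w4 + mu * a * A = 0.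
  apply: (nz B _ B0); move/eqP: e2; rewrite -subr_eq0 => /eqP e2; rewrite -[RHS]e2; ring.
have k2 : w4 - b * w2 - c * mu * A = 0.
  apply: (nz B _ B0); move/eqP: e4; rewrite -subr_eq0 zc => /eqP e4; rewrite -[RHS]e4; ring.
have k3 : - a * w2 + w4 * c - mu * A = 0.
  apply: (nz (mu * A * B)); first by rewrite !mulr_gt0.
  move/eqP: fin; rewrite -subr_eq0 zc => /eqP fin; rewrite -[RHS]fin; ring.
have k4 : w4 * (1 - b ^+ 2) = mu * A * (c - a * b).
  have -> : w4 * (1 - b ^+ 2) = (w4 - b * w2 - c * mu * A) + b * (w2 - b * w4 + mu * a * A)
    + mu * A * (c - a * b) by ring.
  by rewrite k1 k2 mulr0 !add0r.
have k5 : w4 * (c - a * b) = mu.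
  have -> : w4 * (c - a * b) = (- a * w2 + w4 * c - mu * A) + a * (w2 - b * w4 + mu * a * A)
    + mu * (A * (1 - a ^+ 2)) by ring.
  by rewrite k1 k3 mulr0 Aa mulr1 !add0r.
have k6 : (c - a * b) ^+ 2 = (1 - a ^+ 2) * (1 - b ^+ 2).
  apply: (mulfI (lt0r_neq0 (mulr_gt0 mu0 A0))).
  transitivity (mu * A * (c - a * b) * (c - a * b)); first by ring.
  rewrite -k4; transitivity (w4 * (c - a * b) * (1 - b ^+ 2)); first by ring.
  by rewrite k5 -[LHS]mul1r -{1}Aa; ring.
have c1 : c ^+ 2 < 1.
  have E2 : 0 < E ^+ 2 by rewrite exprn_gt0.
  rewrite -subr_gt0 -(pmulr_rgt0 _ E2); move: EGF; rewrite EG FE.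
  by congr (0 < _); ring.
(* The sign of c - ab is the choice of [eps]. *)
have [cs|cs] := leP 0 (c - a * b).
  exists 1; split; first by left.
  by rewrite -k6 sqrtr_sqr ger0_norm // mul1r addrC subrK.
exists (- 1); split; first by right.
by rewrite -k6 sqrtr_sqr ltr0_norm // mulrNN mul1r addrC subrK.
Qed.

End Necessity.

(** * Sufficiency *)

(* [(b, [:: i; j; ..])] stands for [(-1)^b e^i /\ e^j /\ ..]. *)
Definition signed_monomials := seq (bool * seq nat).

Definition mono_mul (m m' : signed_monomials) : signed_monomials :=
  [seq (p.1 (+) q.1, p.2 ++ q.2) | p <- m, q <- m'].

Fixpoint mono_contract (i : nat) (s : seq nat) : signed_monomials :=
  if s is j :: s' then
    (if i == j then [:: (false, s')] else [::]) ++
    [seq (~~ p.1, j :: p.2) | p <- mono_contract i s']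
  else [::].

Definition monos_contract (i : nat) (m : signed_monomials) : signed_monomials :=
  flatten [seq [seq (p.1 (+) q.1, q.2) | q <- mono_contract i p.2] | p <- m].

Fixpoint mono_insert (i : nat) (s : seq nat) : option (bool * seq nat) :=
  if s is j :: s' then
    if (i < j)%N then Some (false, i :: s)
    else if i == j then None
    else if mono_insert i s' is Some (b, t) then Some (~~ b, j :: t) else None
  else Some (false, [:: i]).

Fixpoint mono_sort (s : seq nat) : option (bool * seq nat) :=
  if s is i :: s' then
    if mono_sort s' is Some (b, t) then
      if mono_insert i t is Some (b', t') then Some (b (+) b', t') else None
    else None
  else Some (false, [::]).

Definition mono_normal (m : signed_monomials) : signed_monomials :=
  pmap (fun p : bool * seq nat =>
    omap (fun q : bool * seq nat => (p.1 (+) q.1, q.2)) (mono_sort p.2)) m.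

(** * Evaluation of signed monomials on a family of covectors *)

Section Eval.
Variables (R : realType) (n : nat) (e : nat -> 'rV[R]_n).

Definition mono (s : seq nat) : exterior R n :=
  foldr (fun i => wedge (cov (e i))) (ebasis R set0) s.

Definition eval (m : signed_monomials) : exterior R n :=
  \sum_(p <- m) (-1) ^+ p.1 *: mono p.2.

Lemma mono_cat s t : mono (s ++ t) = wedge (mono s) (mono t).
Proof. by elim: s => [|i s IH] /=; rewrite ?wedge1l // IH wedgeA. Qed.

Lemma wedge_seqsuml (I : Type) (r : seq I) (F : I -> exterior R n) be :
  wedge (\sum_(i <- r) F i) be = \sum_(i <- r) wedge (F i) be.
Proof. by elim/big_rec2: _ => [|i x y _ <-]; rewrite ?wedge0l ?wedgeDl. Qed.

Lemma wedge_seqsumr (I : Type) (r : seq I) (F : I -> exterior R n) be :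
  wedge be (\sum_(i <- r) F i) = \sum_(i <- r) wedge be (F i).
Proof. by elim/big_rec2: _ => [|i x y _ <-]; rewrite ?wedge0r ?wedgeDr. Qed.

Lemma contract_seqsumr (I : Type) (r : seq I) (F : I -> exterior R n) v :
  contract v (\sum_(i <- r) F i) = \sum_(i <- r) contract v (F i).
Proof. by elim/big_rec2: _ => [|i x y _ <-]; rewrite ?contract0r ?contractDr. Qed.

Lemma eval_mul m m' : eval (mono_mul m m') = wedge (eval m) (eval m').
Proof.
rewrite /eval big_allpairs_dep wedge_seqsuml; apply: eq_bigr => p _.
rewrite wedge_seqsumr; apply: eq_bigr => q _ /=.
by rewrite mono_cat wedgeZl wedgeZr scalerA signr_addb.
Qed.

(** All dependence on [v] sits in the scalars [pairing v (e i)]; the rest is contraction by index,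
    which can be computed. *)
Lemma contract_mono v N s : all (fun i => i < N)%N s ->
  contract v (mono s) = \sum_(i < N) pairing v (e i) *: eval (mono_contract i s).
Proof.
elim: s => [_|j s IH /= /andP[jN /IH hs]].
  rewrite big1 => [|i _]; last by rewrite /eval big_nil scaler0.
  exact: contract_ebasis0.
rewrite contract_cov_wedge hs /eval wedge_sumr -sumrN.
under [RHS]eq_bigr => i _ do rewrite big_cat big_map scalerDr /=.
rewrite big_split /=; congr (_ + _).
  rewrite (bigD1 (Ordinal jN)) //= eqxx big_seq1 /= scale1r big1 ?addr0 // => i nij.
  have /negPf -> : (i : nat) != j by apply: contra nij => /eqP h; apply/eqP/val_inj.
  by rewrite big_nil scaler0.
apply: eq_bigr => i _; rewrite wedgeZr wedge_seqsumr -scalerN -sumrN; congr (_ *: _).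
by apply: eq_bigr => p _; rewrite wedgeZr signrN scaleNr.
Qed.

Lemma contract_eval v N m : all (fun p => all (fun i => i < N)%N p.2) m ->
  contract v (eval m) = \sum_(i < N) pairing v (e i) *: eval (monos_contract i m).
Proof.
move=> /allP hm; rewrite /eval contract_seqsumr /monos_contract.
under [RHS]eq_bigr => i _ do rewrite big_flatten big_map scaler_sumr.
rewrite exchange_big /= big_seq [RHS]big_seq; apply: eq_bigr => p /hm hp.
rewrite contractZr (contract_mono v hp) scaler_sumr; apply: eq_bigr => i _.
rewrite big_map /eval !scaler_sumr; apply: eq_bigr => q _ /=.
by rewrite !scalerA signr_addb; congr (_ *: _); ring.
Qed.

Definition oeval (o : option (bool * seq nat)) : exterior R n :=
  if o is Some (b, t) then (-1) ^+ b *: mono t else 0.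

Lemma mono_insertE i s : oeval (mono_insert i s) = mono (i :: s).
Proof.
elim: s => [|j s IH] /=; first by rewrite scale1r.
case: ltnP => [_|_]; first by rewrite /= scale1r.
case: eqP => [->|_] /=; first by rewrite cov_sqA.
rewrite covA -[wedge (cov (e i)) _]/(mono (i :: s)) -IH.
case: (mono_insert i s) => [[b t]|] /=; last by rewrite wedge0r oppr0.
by rewrite wedgeZr signrN scaleNr.
Qed.

Lemma mono_sortE s : oeval (mono_sort s) = mono s.
Proof.
elim: s => [|i s IH] /=; first by rewrite scale1r.
rewrite -IH; case: (mono_sort s) => [[b t]|] /=; last by rewrite wedge0r.
rewrite wedgeZr -[wedge _ _]/(mono (i :: t)) -mono_insertE.
case: (mono_insert i t) => [[b' t']|] /=; last by rewrite scaler0.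
by rewrite scalerA signr_addb.
Qed.

Lemma eval_normal m : eval (mono_normal m) = eval m.
Proof.
rewrite /eval; elim: m => [|[b s] m IH]; first by rewrite !big_nil.
rewrite big_cons /= -(mono_sortE s) /mono_normal /=.
case: (mono_sort s) => [[b' t]|] /=; last by rewrite scaler0 add0r IH.
by rewrite big_cons IH /= scalerA signr_addb.
Qed.

Lemma eval_const m s : all (fun p => p.2 == s) m ->
  eval m = ((count (fun p => ~~ p.1) m)%:R - (count (fun p => p.1) m)%:R) *: mono s.
Proof.
rewrite /eval; elim: m => [|[b t] m IH] /=.
  by rewrite big_nil subrr scale0r.
move=> /andP[/eqP -> /IH h]; rewrite big_cons h -scalerDl /=; congr (_ *: _).
by rewrite !natrD; case: b => /=; ring.
Qed.

End Eval.

(** A standard G2-form with indices from 0: the triples are the lines of a Fano plane. It is e^456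
    plus e^4, e^5, e^6 wedged with the self-dual 2-forms e^01 + e^23, e^03 + e^12, e^02 - e^13. *)
Definition phi0 : signed_monomials :=
  [:: (false, [:: 0; 1; 4]); (false, [:: 2; 3; 4]); (false, [:: 0; 3; 5]);
      (false, [:: 1; 2; 5]); (false, [:: 0; 2; 6]); (true, [:: 1; 3; 6]);
      (false, [:: 4; 5; 6])]%N.

Definition phi0_triple (i j : nat) : signed_monomials :=
  mono_normal (mono_mul (mono_mul (monos_contract i phi0) (monos_contract j phi0)) phi0).

(** The metric identity for pairs of frame vectors, by computation: every surviving monomial sorts
    to e^0123456, and positive signs exceed negative ones by 6 if i = j and by 0 otherwise. *)
Lemma phi0_triple_check : all (fun i => all (fun j =>
   all (fun p => p.2 == iota 0 7) (phi0_triple i j) &&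
   (count (fun p => ~~ p.1) (phi0_triple i j) ==
    count (fun p => p.1) (phi0_triple i j) + 6 * (i == j))%N) (iota 0 7)) (iota 0 7).
Proof. by vm_compute. Qed.

(** * The standard G2-form in a given coframe *)

Section Standard.
Variables (R : realType) (e : nat -> 'rV[R]_7).
Local Notation phi := (eval e phi0).

Lemma eval_phi0_metric v w :
  wedge (wedge (contract v phi) (contract w phi)) phi =
  (6 * \sum_(i < 7) pairing v (e i) * pairing w (e i)) *: mono e (iota 0 7).
Proof.
have tripleE (i j : 'I_7) : wedge (wedge (eval e (monos_contract i phi0))
    (eval e (monos_contract j phi0))) phi = (6 * (i == j)%:R) *: mono e (iota 0 7).
  have mem (k : 'I_7) : val k \in iota 0 7 by rewrite mem_iota /=.
  have /andP[h /eqP c] := allP (allP phi0_triple_check _ (mem i)) _ (mem j).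
  rewrite -!eval_mul -eval_normal (eval_const _ h) c natrD natrM addrAC subrr add0r.
  by rewrite (inj_eq val_inj).
rewrite !(contract_eval _ _ (isT : all (fun p => all (fun i => i < 7)%N p.2) phi0)).
rewrite !wedge_suml mulr_sumr scaler_suml; apply: eq_bigr => i _.
rewrite wedge_sumr wedge_suml (bigD1 i) //= big1 ?addr0 => [|j nji].
  by rewrite !(wedgeZl, wedgeZr) tripleE eqxx mulr1 !scalerA; congr (_ *: _); ring.
by rewrite !(wedgeZl, wedgeZr) tripleE eq_sym (negPf nji) mulr0 scale0r !scaler0.
Qed.

Definition coords x := [seq pairing x (e i) | i <- iota 0 7].

Definition phi0_form (x y z : seq R) : R :=
  let D i j k := x`_i * (y`_j * z`_k - y`_k * z`_j)
    - x`_j * (y`_i * z`_k - y`_k * z`_i) + x`_k * (y`_i * z`_j - y`_j * z`_i) in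
  D 0 1 4 + D 2 3 4 + D 0 3 5 + D 1 2 5 + D 0 2 6 - D 1 3 6 + D 4 5 6.

Lemma tri_eval_phi0 x y z :
  tri phi x y z = phi0_form (coords x) (coords y) (coords z).
Proof.
rewrite /eval /phi0 !big_cons big_nil !triD !triZ /= !wedge1r !tri_cov3.
rewrite /phi0_form /=.
have -> : tri 0 x y z = 0 by rewrite /tri !contract0r ffunE.
by rewrite expr0 expr1; ring.
Qed.

Lemma homog_eval_phi0 : homog 3 phi.
Proof.
have h i j k : homog 3 (mono e [:: i; j; k]).
  rewrite /= wedge1r; apply: (@homog_wedge _ _ 1 2); first exact: homog_cov.
  by apply: (@homog_wedge _ _ 1 1); apply: homog_cov.
rewrite /eval /phi0 !big_cons big_nil.
by do 7![apply: homogD; first by apply: homogZ; apply: h]; apply: homog0.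
Qed.

End Standard.

(** * The explicit purely coclosed structure *)

Section Sufficiency.
Variables (R : realType) (a b c eps sa sb k s : R).
Hypotheses (sa0 : 0 < sa) (sb0 : 0 < sb) (k0 : 0 < k) (s0 : s != 0).
Hypotheses (sa2 : sa ^+ 2 = 1 - a ^+ 2) (sb2 : sb ^+ 2 = 1 - b ^+ 2).
Hypotheses (eps2 : eps ^+ 2 = 1).
Hypotheses (cE : c = a * b + eps * (sa * sb)) (sE : s = eps * (a * sb) - b * sa).
Local Notation f := (fvec R).
Local Notation g := (metric a b (k ^+ 2) (- k ^+ 2 * c) (k ^+ 2)).

(* A coframe orthonormal for [g], chosen so that [u1 * u2] and [u3 * u4] are
   multiples of [f5] and [f6] for the associated G2-structure. *)
Definition coframe (i : nat) : 'rV[R]_7 := nth 0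
  [:: sa *: f i1; sb *: f i2; f i3 + a *: f i1; eps *: (f i4 + b *: f i2);
      k *: (f i5 - c *: f i6); (k * s) *: f i6; f i7] i.
Local Notation e := coframe.
Local Notation phi := (eval e phi0).
Local Notation kap := (sa * sb * eps * k * (k * s)).

(** With a = cos(alpha), sa = sin(alpha), b = cos(beta), sb = sin(beta), one has c = cos(alpha - eps
    beta) and s = -sin(alpha - eps beta). *)
Lemma s_sqr : s ^+ 2 = 1 - c ^+ 2.
Proof.
have -> : s ^+ 2 = eps ^+ 2 * (a ^+ 2 * sb ^+ 2) + b ^+ 2 * sa ^+ 2 - 2 * eps * a * b * sa * sb.
  by rewrite sE; ring.
have -> : c ^+ 2 = a ^+ 2 * b ^+ 2 + eps ^+ 2 * (sa ^+ 2 * sb ^+ 2) + 2 * eps * a * b * sa * sb.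
  by rewrite cE; ring.
by rewrite eps2 sa2 sb2; ring.
Qed.

Lemma coordsE x : coords e x =
  [:: sa * x 0 i1; sb * x 0 i2; x 0 i3 + a * x 0 i1; eps * (x 0 i4 + b * x 0 i2);
      k * (x 0 i5 - c * x 0 i6); k * s * x 0 i6; x 0 i7].
Proof.
have pf i : pairing x (f i) = x 0 i by rewrite pairingC; apply: pairing_delta.
rewrite /coords /coframe /= -[- (c *: _)]scaleNr !(pairingDr, pairingZr) !pf.
by rewrite mulNr.
Qed.

Lemma coframe_metric v w : bilin g v w = \sum_(i < 7) pairing v (e i) * pairing w (e i).
Proof.
have -> : \sum_(i < 7) pairing v (e i) * pairing w (e i) =
   \sum_(i < 7) (coords e v)`_i * (coords e w)`_i.
  by apply: eq_bigr => i _; rewrite !(nth_map 0%N) ?size_iota // !nth_iota.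
rewrite bilin_metric !coordsE !big_ord_recl big_ord0 /=.
set v1 := v 0 i1; set v2 := v 0 i2; set v3 := v 0 i3; set v4 := v 0 i4.
set v5 := v 0 i5; set v6 := v 0 i6; set v7 := v 0 i7.
set w1 := w 0 i1; set w2 := w 0 i2; set w3 := w 0 i3; set w4 := w 0 i4.
set w5 := w 0 i5; set w6 := w 0 i6; set w7 := w 0 i7.
(* The squares are isolated so that [sa2], [sb2], [eps2] and [s_sqr] can be substituted. *)
transitivity (sa ^+ 2 * (v1 * w1) + sb ^+ 2 * (v2 * w2) + (v3 + a * v1) * (w3 + a * w1)
  + eps ^+ 2 * ((v4 + b * v2) * (w4 + b * w2))
  + k ^+ 2 * ((v5 - c * v6) * (w5 - c * w6)) + k ^+ 2 * (s ^+ 2 * (v6 * w6)) + v7 * w7).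
  by rewrite sa2 sb2 eps2 s_sqr; ring.
by ring.
Qed.

Lemma coframe_inner_product : inner_product g.
Proof.
split=> [|v v0].
  apply/matrixP => i j; rewrite mxE -!bilin_delta !coframe_metric.
  by apply: eq_bigr => l _; rewrite mulrC.
rewrite coframe_metric lt_def sumr_ge0 ?andbT => [|i _]; last by rewrite -expr2 sqr_ge0.
apply: contra v0; rewrite psumr_eq0 => [|i _]; last by rewrite -expr2 sqr_ge0.
move=> /allP h.
have z i : (i < 7)%N -> (coords e v)`_i = 0.
  move=> i7; have := h (Ordinal i7) (mem_index_enum _); rewrite /= mulf_eq0 orbb => /eqP.
  by rewrite (nth_map 0%N) ?size_iota // nth_iota.
have sa1 := lt0r_neq0 sa0; have sb1 := lt0r_neq0 sb0; have k1 := lt0r_neq0 k0.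
have eps1 : eps != 0 by rewrite -sqrf_eq0 eps2 oner_eq0.
have ks : k * s != 0 by rewrite mulf_neq0.
rewrite coordsE in z.
have v1 : v 0 i1 = 0 by apply: (mulfI sa1); rewrite mulr0; exact: (z 0%N isT).
have v2 : v 0 i2 = 0 by apply: (mulfI sb1); rewrite mulr0; exact: (z 1%N isT).
have v3 : v 0 i3 = 0 by have := z 2%N isT; rewrite /= v1 mulr0 addr0.
have v4 : v 0 i4 = 0.
  by have := z 3%N isT; rewrite /= v2 mulr0 addr0 => h4; apply: (mulfI eps1); rewrite mulr0.
have v6 : v 0 i6 = 0 by apply: (mulfI ks); rewrite mulr0; exact: (z 5%N isT).
have v5 : v 0 i5 = 0.
  by have := z 4%N isT; rewrite /= v6 mulr0 subr0 => h4; apply: (mulfI k1); rewrite mulr0.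
have v7 : v 0 i7 = 0 by exact: (z 6%N isT).
by rewrite (row_expand v) big_I7 v1 v2 v3 v4 v5 v6 v7 !scale0r !addr0.
Qed.

(** Multiples of a covector that already occurs in the product are absorbed, so only the scalings
    contribute. *)
Lemma coframe_volume : mono e (iota 0 7) = kap *: ebasis R setT.
Proof.
have absorb (x y : 'rV[R]_7) l al : wedge (cov x) (wedge (cov (y + l *: x)) al) =
    wedge (cov x) (wedge (cov y) al).
  by rewrite covD covZ wedgeDl wedgeZl wedgeDr wedgeZr cov_sqA scaler0 addr0.
have absorb2 (x y z : 'rV[R]_7) l al :
    wedge (cov x) (wedge (cov y) (wedge (cov (z + l *: x)) al)) =
    wedge (cov x) (wedge (cov y) (wedge (cov z) al)).
  by rewrite (covA x y) absorb [RHS](covA x y).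
have absorb3 (x y : 'rV[R]_7) l al :
    wedge (cov (y - l *: x)) (wedge (cov x) al) = wedge (cov y) (wedge (cov x) al).
  by rewrite -scaleNr covD covZ wedgeDl wedgeZl cov_sqA scaler0 addr0.
have eT : ebasis R setT = wedge_seq R [:: i1; i2; i3; i4; i5; i6; i7].
  rewrite -wedge_seq_enum -[in LHS](_ : [set i in [:: i1; i2; i3; i4; i5; i6; i7]] = setT).
    by rewrite enum_sorted.
  by apply/setP => i; rewrite !inE; case: i => -[|[|[|[|[|[|[|]]]]]]].
rewrite eT /= -!cov_delta -!/(fvec R _) /coframe /=.
rewrite (covZ sa) (covZ sb) (covZ eps) (covZ k) (covZ (k * s)) !(wedgeZl, wedgeZr).
by rewrite !absorb2 absorb3 !scalerA; congr (_ *: _); ring.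
Qed.

(** Identifies the absolute value of the volume coefficient with the square root of det g. In the
    triangular coframe f^5 and f^6 exchange roles, which respects [g] because E = G. *)
Lemma det_coframe_metric : \det g = kap ^+ 2.
Proof.
(* Unlike [coframe], the following orthonormal coframe is triangular. *)
pose D : 'M[R]_7 := \matrix_(i, j) (nth 0
  [:: sa *: f i1; sb *: f i2; f i3 + a *: f i1; f i4 + b *: f i2;
      (k * s) *: f i5; k *: (f i6 - c *: f i5); f i7] i : 'rV[R]_7) 0 j.
have gD : g = D^T *m D.
  have pd v : [/\ pairing v (row i1 D) = sa * v 0 i1, pairing v (row i2 D) = sb * v 0 i2,
      pairing v (row i3 D) = v 0 i3 + a * v 0 i1, pairing v (row i4 D) = v 0 i4 + b * v 0 i2 &
      [/\ pairing v (row i5 D) = k * s * v 0 i5, pairing v (row i6 D) = k * (v 0 i6 - c * v 0 i5) &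
      pairing v (row i7 D) = v 0 i7]].
    have pf i : pairing v (f i) = v 0 i by rewrite pairingC; apply: pairing_delta.
    have rowD i : row i D = nth 0
      [:: sa *: f i1; sb *: f i2; f i3 + a *: f i1; f i4 + b *: f i2;
      (k * s) *: f i5; k *: (f i6 - c *: f i5); f i7] i by apply/rowP => j; rewrite !mxE.
    by rewrite !rowD /= -[- (c *: _)]scaleNr !(pairingDr, pairingZr) !pf mulNr.
  apply/matrixP => i j; rewrite -bilin_delta.
  have DE l p : D l p = pairing (f p) (row l D) by rewrite [RHS]pairing_delta [RHS]mxE.
  have -> : (D^T *m D) i j = \sum_l pairing (f i) (row l D) * pairing (f j) (row l D).
    by rewrite mxE; apply: eq_bigr => l _; rewrite mxE !DE.
  rewrite -!/(fvec R _) bilin_metric big_I7.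
  have [-> -> -> -> [-> -> ->]] := pd (f i); have [-> -> -> -> [-> -> ->]] := pd (f j).
  move: (f i) (f j) => v w.
  transitivity (sa ^+ 2 * (v 0 i1 * w 0 i1) + sb ^+ 2 * (v 0 i2 * w 0 i2)
    + (v 0 i3 + a * v 0 i1) * (w 0 i3 + a * w 0 i1) + (v 0 i4 + b * v 0 i2) * (w 0 i4 + b * w 0 i2)
    + k ^+ 2 * (s ^+ 2 * (v 0 i5 * w 0 i5)) + k ^+ 2 * ((v 0 i6 - c * v 0 i5) * (w 0 i6 - c * w 0 i5))
    + v 0 i7 * w 0 i7).
    by rewrite sa2 sb2 s_sqr; ring.
  by ring.
have Dtrig : is_trig_mx D.
  apply/is_trig_mxP => i j; rewrite mxE.
  case: i => -[|[|[|[|[|[|[|//]]]]]]] ip; case: j => -[|[|[|[|[|[|[|//]]]]]]] jp //= _;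
  by rewrite !mxE /=; ring.
rewrite gD det_mulmx det_tr (det_trig Dtrig).
have -> : \prod_i D i i = sa * sb * k * (k * s).
  rewrite !big_ord_recl big_ord0 !mxE /=; ring.
by rewrite -[LHS]mul1r -eps2; ring.
Qed.
Definition coframe_vol : exterior R 7 := kap *: ebasis R setT.
Local Notation om := coframe_vol.

Lemma coframe_kap_neq0 : kap != 0.
Proof.
have eps1 : eps != 0 by rewrite -sqrf_eq0 eps2 oner_eq0.
have sa1 := lt0r_neq0 sa0; have sb1 := lt0r_neq0 sb0; have k1 := lt0r_neq0 k0.
by rewrite !mulf_neq0.
Qed.

Lemma coframe_triple v w :
  wedge (wedge (contract v phi) (contract w phi)) phi = (6 * bilin g v w) *: om.
Proof. by rewrite eval_phi0_metric coframe_volume coframe_metric. Qed.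

Lemma coframe_G2_metric_vol : G2_metric_vol phi g om.
Proof.
split=> [||v w]; first exact: coframe_inner_product.
  (* The orientation is the sign of the volume coefficient. *)
  by exists (kap < 0); rewrite det_coframe_metric sqrtr_sqr -numEsign.
by rewrite coframe_triple [RHS]scalerA mulKf ?pnatr_eq0.
Qed.

Lemma coframe_G2_structure : G2_structure phi.
Proof.
split=> [|v v0]; first exact: homog_eval_phi0.
rewrite coframe_triple; apply/eqP => /ffunP/(_ setT)/eqP.
rewrite /coframe_vol !ext_scaleE !ffunE eqxx mulr1 mulf_eq0 (negPf coframe_kap_neq0) orbF.
by rewrite mulf_eq0 pnatr_eq0 /= gt_eqF // coframe_inner_product.2.
Qed.

Local Notation u i := (usharp g i).

Lemma coframe_coords :
  [/\ coords e (u i1) = [:: sa^-1; 0; 0; 0; 0; 0; 0],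
      coords e (u i2) = [:: 0; sb^-1; 0; 0; 0; 0; 0],
      coords e (u i3) = [:: - a / sa; 0; 1; 0; 0; 0; 0],
      coords e (u i4) = [:: 0; - b / sb; 0; eps; 0; 0; 0] &
      [/\ coords e (u i5) = [:: 0; 0; 0; 0; k^-1; c / (k * s); 0],
          coords e (u i6) = [:: 0; 0; 0; 0; 0; (k * s)^-1; 0] &
          coords e (u i7) = [:: 0; 0; 0; 0; 0; 0; 1]]].
Proof.
have sa1 := lt0r_neq0 sa0; have sb1 := lt0r_neq0 sb0; have k1 := lt0r_neq0 k0.
have us := bilin_usharp coframe_G2_metric_vol.
have ueq i x : (forall w, bilin g x w = w 0 i) -> u i = x.
  by move=> h; apply: (bilin_inj coframe_inner_product) => w; rewrite us h.
have an : 1 - a ^+ 2 != 0 by rewrite -sa2 expf_neq0.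
have bn : 1 - b ^+ 2 != 0 by rewrite -sb2 expf_neq0.
have cn : 1 - c ^+ 2 != 0 by rewrite -s_sqr expf_neq0.
have -> : u i1 = (1 - a ^+ 2)^-1 *: (f i1 - a *: f i3).
  by apply: ueq => w; rewrite bilin_metric !mxE /=; field.
have -> : u i2 = (1 - b ^+ 2)^-1 *: (f i2 - b *: f i4).
  by apply: ueq => w; rewrite bilin_metric !mxE /=; field.
have -> : u i3 = (1 - a ^+ 2)^-1 *: (f i3 - a *: f i1).
  by apply: ueq => w; rewrite bilin_metric !mxE /=; field.
have -> : u i4 = (1 - b ^+ 2)^-1 *: (f i4 - b *: f i2).
  by apply: ueq => w; rewrite bilin_metric !mxE /=; field.
have -> : u i5 = (k ^+ 2 * (1 - c ^+ 2))^-1 *: (f i5 + c *: f i6).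
  by apply: ueq => w; rewrite bilin_metric !mxE /=; field; rewrite k1 cn.
have -> : u i6 = (k ^+ 2 * (1 - c ^+ 2))^-1 *: (f i6 + c *: f i5).
  by apply: ueq => w; rewrite bilin_metric !mxE /=; field; rewrite k1 cn.
have -> : u i7 = f i7 by apply: ueq => w; rewrite bilin_metric !mxE /=; ring.
rewrite !coordsE !mxE /=; split; last split.
- congr [:: _; _; _; _; _; _; _]; rewrite -?sa2; field; rewrite ?sa1 //.
- congr [:: _; _; _; _; _; _; _]; rewrite -?sb2; field; rewrite ?sb1 //.
- congr [:: _; _; _; _; _; _; _]; try ring.
    by rewrite -sa2; field.
  by field.
- congr [:: _; _; _; _; _; _; _]; try ring.
    by rewrite -sb2; field.
  by field.
- congr [:: _; _; _; _; _; _; _]; try ring.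
    by field; rewrite k1 cn.
  by rewrite -s_sqr; field; rewrite k1 s0.
- congr [:: _; _; _; _; _; _; _]; try ring.
  by rewrite -s_sqr; field; rewrite k1 s0.
- by congr [:: _; _; _; _; _; _; _]; ring.
Qed.

(** In the frame E_0, ..., E_6 dual to the coframe, f_5 = k E_4 and f_6 = k (s E_5 - c E_4). Then
    u_1 * u_2 = E_4 / (sa sb) is a multiple of f_5, and u_3 * u_4 = (c E_4 - s E_5) / (sa sb) is a
    multiple of f_6, with opposite coefficients. *)
Lemma coframe_purely_coclosed : purely_coclosed (@h3h3R_br R) phi.
Proof.
have sa1 := lt0r_neq0 sa0; have sb1 := lt0r_neq0 sb0; have k1 := lt0r_neq0 k0.
have hG := coframe_G2_metric_vol; exists g, om; split=> //.
  have [_ /homog_volume hom _] := hG.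
  apply/(coclosedP g hom (om_top_neq0 hG) (@homog_eval_phi0 R e)).
  have [c1 c2 c3 c4 [c5 c6 c7]] := coframe_coords.
  split.
  - move=> j j5 j6; rewrite tri_eval_phi0 c1 c2.
    case: j j5 j6 => -[|[|[|[|[|[|[|//]]]]]]] jp // _ _.
    + rewrite (_ : Ordinal jp = i1) ?c1 /phi0_form /=; last exact: val_inj.
      by ring.
    + rewrite (_ : Ordinal jp = i2) ?c2 /phi0_form /=; last exact: val_inj.
      by ring.
    + rewrite (_ : Ordinal jp = i3) ?c3 /phi0_form /=; last exact: val_inj.
      by ring.
    + rewrite (_ : Ordinal jp = i4) ?c4 /phi0_form /=; last exact: val_inj.
      by ring.
    + rewrite (_ : Ordinal jp = i7) ?c7 /phi0_form /=; last exact: val_inj.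
      by ring.
  - move=> j j5 j6; rewrite tri_eval_phi0 c3 c4.
    case: j j5 j6 => -[|[|[|[|[|[|[|//]]]]]]] jp // _ _.
    + rewrite (_ : Ordinal jp = i1) ?c1 /phi0_form /=; last exact: val_inj.
      by ring.
    + rewrite (_ : Ordinal jp = i2) ?c2 /phi0_form /=; last exact: val_inj.
      by ring.
    + rewrite (_ : Ordinal jp = i3) ?c3 /phi0_form /=; last exact: val_inj.
      by ring.
    + rewrite (_ : Ordinal jp = i4) ?c4 /phi0_form /=; last exact: val_inj.
      by ring.
    + rewrite (_ : Ordinal jp = i7) ?c7 /phi0_form /=; last exact: val_inj.
      by ring.
  - rewrite !tri_eval_phi0 c1 c2 c3 c4 c5 c6 /phi0_form /=.
    (* Both sides vanish; the right-hand one is a multiple of c - (c / s) s. *)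
    transitivity (0 : R); first by ring.
    transitivity ((k * sa * sb)^-1 * ((a * b + eps * (sa * sb)) - c / s * (eps * (a * sb) - b * sa))).
      by rewrite -cE -sE; field; rewrite k1 sa1 sb1 s0.
    by field; rewrite k1 sa1 sb1 s0.
apply/(pureP (@homog_eval_phi0 R e) hG).
have [c1 c2 c3 c4 _] := coframe_coords.
rewrite !tri_eval_phi0 c1 c2 c3 c4 !coordsE !mxE /phi0_form /=.
(* Pureness reduces to 1 - c^2 - s^2 = 0. *)
transitivity (k / (sa * sb) * (1 - c * (a * b + eps * (sa * sb)) - s * (eps * (a * sb) - b * sa))).
  by field; rewrite sa1 sb1.
by rewrite -cE -sE -!expr2 s_sqr subrr mulr0.
Qed.

End Sufficiency.

(** * The equivalence and the orthogonal case *)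

Theorem proposition5p6 (R : realType) :
  (forall a b E F G : R,
     0 <= a -> a <= b -> b < 1 ->
     0 <= E -> 0 <= F -> 0 <= G -> 0 < E * G - F ^+ 2 ->
     (exists phi : exterior R 7,
        [/\ G2_structure phi, purely_coclosed (@h3h3R_br R) phi
          & induces phi (metric a b E F G)])
     <->
     (exists eps : R,
        (eps = 1 \/ eps = -1) /\
        let c := a * b + eps * Num.sqrt ((1 - a ^+ 2) * (1 - b ^+ 2)) in
        [/\ c ^+ 2 < 1, G = E & F = - E * c]))
  /\
  (forall g : 'M[R]_7,
     inner_product g -> orthogonal_decomposition g ->
     ~ exists phi : exterior R 7,
         [/\ G2_structure phi, purely_coclosed (@h3h3R_br R) phi
           & induces phi g]).
Proof.
split=> [a b E F G a0 ab b1 E0 _ _ EGF|g]; last exact: orthogonal_not_pcc.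
split=> [[phi]|[eps [epsE [c1 GE FE]]]]; first exact: pcc_metric_necessary.
set c := a * b + _ in c1 FE.
have a2 : 0 < 1 - a ^+ 2 by nra.
have b2 : 0 < 1 - b ^+ 2 by nra.
have En : 0 < E.
  rewrite lt_def E0 andbT; apply: contraTneq EGF => ->.
  by rewrite mul0r sub0r oppr_gt0 ltNge sqr_ge0.
pose k := Num.sqrt E; pose sa := Num.sqrt (1 - a ^+ 2); pose sb := Num.sqrt (1 - b ^+ 2).
have k0 : 0 < k by rewrite sqrtr_gt0.
have sa0 : 0 < sa by rewrite sqrtr_gt0.
have sb0 : 0 < sb by rewrite sqrtr_gt0.
have sa2 : sa ^+ 2 = 1 - a ^+ 2 by rewrite sqr_sqrtr // ltW.
have sb2 : sb ^+ 2 = 1 - b ^+ 2 by rewrite sqr_sqrtr // ltW.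
have eps2 : eps ^+ 2 = 1 by case: epsE => ->; rewrite ?sqrrN expr1n.
have cE : c = a * b + eps * (sa * sb) by rewrite /c sqrtrM // ltW.
have kE : k ^+ 2 = E by rewrite sqr_sqrtr.
pose s := eps * (a * sb) - b * sa.
(* Here c^2 < 1 enters: it keeps f_5 and f_6 independent in the coframe. *)
have sn : s != 0.
  by rewrite -sqrf_eq0 (s_sqr sa2 sb2 eps2 cE (erefl s)) gt_eqF // subr_gt0.
exists (eval (coframe a b c eps sa sb k s) phi0).
have hG := coframe_G2_metric_vol sa0 sb0 k0 sn sa2 sb2 eps2 cE (erefl s).
split.
- exact: (coframe_G2_structure sa0 sb0 k0 sn sa2 sb2 eps2 cE (erefl s)).
- exact: (coframe_purely_coclosed sa0 sb0 k0 sn sa2 sb2 eps2 cE (erefl s)).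
by rewrite GE FE -kE; eexists; exact: hG.
Qed.
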